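(* There is an absolute constant $d>0$ (independent of $n$ and $K$) such that for every $n\ge 1$ and every convex body $K\subset\mathbb{R}^n$ there is a simplex $S\subset\mathbb{R}^n$ with $K\subset S$ and $\mathrm{bar}(S)=\mathrm{bar}(K)$ such that $$\left(\frac{\mathrm{vol}(S)}{\mathrm{vol}(K)}\right)^{1/n}\le d\sqrt{n}.$$
   Context: A convex body in $\mathbb{R}^n$ is a compact convex set with non-empty interior. $\mathrm{vol}$ denotes Lebesgue measure in $\mathbb{R}^n$. A simplex in $\mathbb{R}^n$ always means an $n$-simplex, i.e. the convex hull of $n+1$ affinely independent points of $\mathbb{R}^n$. The barycenter of a convex body $K$ is $\mathrm{bar}(K)=\frac{1}{\mathrm{vol}(K)}\int_K x\,dx$. *)

(* Defs.v *)
From HB Require Import structures.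
From mathcomp Require Import all_boot all_order all_algebra.
From mathcomp Require Import all_classical all_reals all_analysis.
From mathcomp Require Import measurable_realfun.

Set Implicit Arguments.
Unset Strict Implicit.
Unset Printing Implicit Defensive.

Import Order.TTheory GRing.Theory Num.Theory.
Import numFieldNormedType.Exports.

Local Open Scope classical_set_scope.
Local Open Scope ring_scope.

(* Matrices, hence the row vectors 'rV[R]_n standing for R^n, carry their
   Borel sigma-algebra. *)
Definition borel_mx_display : measure_display.
Proof. exact: default_measure_display. Qed.

Section borel_mx.
Context (R : realType) (m n : nat).

Definition borel_mx : set (set 'M[R]_(m, n)) := <<s open >>.

Let borel_mx0 : borel_mx set0.
Proof. exact: sigma_algebra0. Qed.

Let borel_mxC A : borel_mx A -> borel_mx (~` A).
Proof. exact: sigma_algebraC. Qed.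

Let borel_mx_bigcup (F : (set 'M[R]_(m, n))^nat) :
  (forall i, borel_mx (F i)) -> borel_mx (\bigcup_i F i).
Proof. exact: sigma_algebra_bigcup. Qed.

HB.instance Definition _ := @isMeasurable.Build borel_mx_display
  'M[R]_(m, n) borel_mx borel_mx0 borel_mxC borel_mx_bigcup.

Lemma open_measurable_mx (U : set 'M[R]_(m, n)) : open U -> measurable U.
Proof. exact: sub_sigma_algebra. Qed.

Lemma measurable_coord_mx i j :
  measurable_fun [set: 'M[R]_(m, n)] (fun M => M i j : measurableTypeR R).
Proof.
apply: (measurability _ (RGenOpens.measurableE R)) => _ [_ [a [b ->]] <-].
rewrite setTI; apply: open_measurable_mx.
by apply: open_comp => [x _|]; [exact: coord_continuous|exact: interval_open].
Qed.

Lemma open_mx_bigcup (U : set 'M[R]_(m, n)) : open U ->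
  U = \bigcup_(p : 'M[rat]_(m, n) * nat)
    (if `[< ball (map_mx ratr p.1 : 'M[R]_(m, n)) p.2.+1%:R^-1 `<=` U >]
     then [set M | forall i j, ball (ratr (p.1 i j) : R) p.2.+1%:R^-1 (M i j)]
     else set0).
Proof.
move=> oU; apply/seteqP; split => [M UM|M [[q k] _]] /=; last first.
  case: ifPn => // /asboolP qU qM; apply: qU; split => // i j.
  by rewrite mxE; exact: qM.
have /nbhs_ballP[e /= e0 eU] : nbhs M U by exact: open_nbhs_nbhs.
have [k ke] : exists k : nat, k.+1%:R^-1 < e / 2 :> R.
  exists (Num.truncn (e / 2)^-1).
  by rewrite invf_plt ?posrE ?divr_gt0// truncnS_gt.
pose r : R := k.+1%:R^-1.
have r0 : 0 < r by rewrite invr_gt0.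
have q_ij i j : {q : rat | ball (ratr q : R) r (M i j)}.
  apply/cid; have /rat_in_itvoo[q] : M i j - r < M i j + r.
    by rewrite ltrD2l gtrN.
  by rewrite in_itv /= => qM; exists q; rewrite -ball_normE /= ltr_distl.
pose q : 'M[rat]_(m, n) := \matrix_(i, j) sval (q_ij i j).
exists (q, k) => //=; rewrite ifT.
  by move=> i j; rewrite mxE; case: (q_ij i j).
apply/asboolP => N [_ qN]; apply: eU; split => // i j.
have := qN i j; rewrite !mxE => qNij.
have re : r + r <= e by rewrite [leRHS]splitr lerD// ltW.
apply: (le_ball re); apply: ball_triangle qNij.
by apply: ball_sym; case: (q_ij i j).
Qed.

Lemma measurable_fun_mxP d (T : measurableType d) (f : T -> 'M[R]_(m, n)) :
  measurable_fun setT f <->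
  forall i j, measurable_fun setT (fun x => f x i j : measurableTypeR R).
Proof.
split=> [mf i j|mf].
  exact: (measurableT_comp (measurable_coord_mx i j) mf).
apply: (@measurability _ _ _ _ setT f open) => // _ [U oU <-].
rewrite setTI (open_mx_bigcup oU) preimage_bigcup.
apply: countable_bigcupT_measurable => [|[q k]]; first exact: countableP.
case: ifP => _ /=; last by rewrite preimage_set0.
rewrite [X in measurable X](_ : _ = \big[setI/setT]_i \big[setI/setT]_j
    (setT `&` (fun x => f x i j) @^-1` ball (ratr (q i j) : R) k.+1%:R^-1)).
  apply: bigsetI_measurable => i _; apply: bigsetI_measurable => j _.
  by apply: mf => //; exact: measurable_ball.
apply/seteqP; split=> x /=; rewrite -bigcap_seq /=.
  move=> fx i _; rewrite -bigcap_seq /= => j _; split => //; exact: fx.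
move=> fx i j; have := fx i (mem_index_enum i).
by rewrite -bigcap_seq /= => /(_ j (mem_index_enum j))[].
Qed.

End borel_mx.

Section lebesgue_rV.
Context (R : realType).

Definition cons_rV n (p : measurableTypeR R * 'rV[R]_n) : 'rV[R]_n.+1 :=
  row_mx (p.1 : R)%:M p.2.

Definition uncons_rV n (v : 'rV[R]_n.+1) : measurableTypeR R * 'rV[R]_n :=
  (v 0 0 : R, \row_j v 0 (lift ord0 j)).

Lemma cons_rV0 n p : @cons_rV n p 0 0 = p.1.
Proof.
transitivity (row_mx (p.1 : R)%:M p.2 (0 : 'I_1) (lshift n 0)).
  by congr (row_mx _ _ _ _); exact: val_inj.
by rewrite row_mxEl mxE.
Qed.

Lemma cons_rVS n p j : @cons_rV n p 0 (lift ord0 j) = p.2 0 j.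
Proof.
transitivity (row_mx (p.1 : R)%:M p.2 (0 : 'I_1) (rshift 1 j)).
  by congr (row_mx _ _ _ _); exact: val_inj.
by rewrite row_mxEr.
Qed.

Lemma cons_rVK n : cancel (@cons_rV n) (@uncons_rV n).
Proof.
move=> [x v]; rewrite /uncons_rV cons_rV0; congr pair.
by apply/rowP => j; rewrite mxE cons_rVS.
Qed.

Lemma measurable_cons_rV n : measurable_fun setT (@cons_rV n).
Proof.
apply/measurable_fun_mxP => i j; rewrite ord1.
case: (unliftP ord0 j) => [k|] ->.
  under eq_fun do rewrite cons_rVS.
  exact: (measurableT_comp (measurable_coord_mx _ _) measurable_snd).
under eq_fun do rewrite cons_rV0.
exact: measurable_fst.
Qed.

Lemma measurable_uncons_rV n : measurable_fun setT (@uncons_rV n).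
Proof.
apply/measurable_fun_pairP; split; first exact: measurable_coord_mx.
apply/measurable_fun_mxP => i j /=.
under eq_fun do rewrite mxE.
exact: measurable_coord_mx.
Qed.

(* Lebesgue measure on R^n as the n-fold product of the Lebesgue measure on R;
   lebesgue_rV_box below gives its value on boxes. *)
Fixpoint lebesgue_rV n : set 'rV[R]_n -> \bar R :=
  if n is n'.+1
  then pushforward (lebesgue_measure \x @lebesgue_rV n')%E (@cons_rV n')
  else \d_(0 : 'rV[R]_0).

Section prod_lebesgue_rV.
Context n (mu : {sigma_finite_measure set 'rV[R]_n -> \bar R}).

Definition prod_lebesgue_rV : set 'rV[R]_n.+1 -> \bar R :=
  pushforward (lebesgue_measure \x mu)%E (@cons_rV n).

Local Notation nu := prod_lebesgue_rV.

Let mcons := @measurable_cons_rV n.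

Let nu0 : nu set0 = 0%E.
Proof. exact: (@measure0 _ _ _ (pushforward _ _)). Qed.

Let nu_ge0 A : (0 <= nu A)%E.
Proof. exact: (@measure_ge0 _ _ _ (pushforward _ _)). Qed.

Let nu_sigma_additive : semi_sigma_additive nu.
Proof. exact: (@measure_semi_sigma_additive _ _ _ (pushforward _ _)). Qed.

HB.instance Definition _ := isMeasure.Build _ _ _ nu
  nu0 nu_ge0 nu_sigma_additive.

Let nu_sigma_finite : sigma_finite setT nu.
Proof.
have /sigma_finiteP[F [TF ndF Foo]] := sigma_finiteT (@lebesgue_measure R).
have /sigma_finiteP[G [TG ndG Goo]] := sigma_finiteT mu.
exists (fun k => @uncons_rV n @^-1` (F k `*` G k)).
  rewrite -preimage_bigcup [X in _ @^-1` X](_ : _ = setT) ?preimage_setT//.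
  apply/seteqP; split=> // -[x v] _.
  have [k _ Fkx] : (\bigcup_k F k) x by rewrite -TF.
  have [l _ Glv] : (\bigcup_k G k) v by rewrite -TG.
  exists (maxn k l) => //; split.
    by move: x Fkx; exact/subsetPset/ndF/leq_maxl.
  by move: v Glv; exact/subsetPset/ndG/leq_maxr.
move=> k; have [mF Fy] := Foo k; have [mG Gy] := Goo k; split.
  rewrite -[X in measurable X]setTI; apply: measurable_uncons_rV => //.
  exact: measurableX.
rewrite /prod_lebesgue_rV /pushforward -comp_preimage (_ : _ \o _ = id).
  by rewrite preimage_id product_measure1E// lte_mul_pinfty// ge0_fin_numE.
by apply/funext => p; exact: cons_rVK.
Qed.

HB.instance Definition _ := Measure_isSigmaFinite.Build _ _ _ nu
  nu_sigma_finite.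

End prod_lebesgue_rV.

Lemma lebesgue_rV_subproof n :
  {mu : {sigma_finite_measure set 'rV[R]_n -> \bar R} |
    mu = @lebesgue_rV n :> (set _ -> \bar R)}.
Proof.
elim: n => [|n [mu muE]]; first by exists \d_(0 : 'rV[R]_0).
exists (prod_lebesgue_rV mu).
exact: (congr1 (fun m => pushforward (lebesgue_measure \x m)%E _) muE).
Qed.

Let lebesgue_rV0 n : @lebesgue_rV n set0 = 0%E.
Proof. by case: (lebesgue_rV_subproof n) => mu <-; exact: measure0. Qed.

Let lebesgue_rV_ge0 n A : (0 <= @lebesgue_rV n A)%E.
Proof. by case: (lebesgue_rV_subproof n) => mu <-; exact: measure_ge0. Qed.

Let lebesgue_rV_sigma_additive n : semi_sigma_additive (@lebesgue_rV n).
Proof.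
case: (lebesgue_rV_subproof n) => mu <-; exact: measure_semi_sigma_additive.
Qed.

HB.instance Definition _ n := isMeasure.Build _ _ _ (@lebesgue_rV n)
  (@lebesgue_rV0 n) (@lebesgue_rV_ge0 n) (@lebesgue_rV_sigma_additive n).

Let lebesgue_rV_sigma_finite n : sigma_finite setT (@lebesgue_rV n).
Proof. by case: (lebesgue_rV_subproof n) => mu <-; exact: sigma_finiteT. Qed.

HB.instance Definition _ n := Measure_isSigmaFinite.Build _ _ _
  (@lebesgue_rV n) (@lebesgue_rV_sigma_finite n).

End lebesgue_rV.
Arguments lebesgue_rV {R n}.

Lemma lebesgue_rV_box (R : realType) n (A : 'I_n -> set (measurableTypeR R)) :
  (forall i, measurable (A i)) ->
  lebesgue_rV [set v : 'rV[R]_n | forall i, A i (v 0 i)] =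
  (\prod_(i < n) lebesgue_measure (A i))%E.
Proof.
elim: n A => [|n IH] A mA.
  rewrite big_ord0 /= diracE mem_set//= => -[].
  by case.
rewrite big_ord_recl -(IH (fun i => A (lift ord0 i)))// -product_measure1E//.
  rewrite /= /pushforward; congr ((_ \x _)%E _).
  apply/seteqP; split=> [[x v]/= Av|[x v]/= [Ax Av] i].
    split=> [|i]; first by have := Av ord0; rewrite cons_rV0.
    by have := Av (lift ord0 i); rewrite cons_rVS.
  by case: (unliftP ord0 i) => [j|] ->; rewrite ?cons_rVS ?cons_rV0.
rewrite (_ : [set _ | _] = \big[setI/setT]_(i < n)
    (setT `&` (fun v : 'rV[R]_n => v 0 i) @^-1` A (lift ord0 i))).
  by apply: bigsetI_measurable => i _; exact: measurable_coord_mx.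
apply/seteqP; split=> v /=; rewrite -bigcap_seq /=.
  by move=> Av i _; split => //; exact: Av.
by move=> Av i; have [] := Av i (mem_index_enum i).
Qed.

(* On compact sets lebesgue_rV is finite, so fine loses nothing there. *)
Definition vol (R : realType) n (A : set 'rV[R]_n) : R := fine (lebesgue_rV A).

Definition barycenter (R : realType) n (A : set 'rV[R]_n) : 'rV[R]_n :=
  (vol A)^-1 *: \row_i \int[lebesgue_rV]_(x in A) x 0 i.

Definition convex_body (R : realType) n (K : set 'rV[R]_n) : Prop :=
  [/\ compact K, convex_set K & K^° !=set0].

Definition convex_hull (R : numDomainType) (E : lmodType R) (A : set E) :
  set E := smallest (@convex_set R E) A.

Definition affinely_independent (R : pzRingType) (E : lmodType R)
    (I : finType) (v : I -> E) : Prop :=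
  forall c : I -> R, \sum_i c i = 0 -> \sum_i c i *: v i = 0 ->
    forall i, c i = 0.

Definition simplex (R : realType) n (S : set 'rV[R]_n) : Prop :=
  exists2 v : 'I_n.+1 -> 'rV[R]_n,
    affinely_independent v & S = convex_hull (range v).

(* Main.v *)
(** Let [L = K - K] and let [Y] be the polar of [L]. The affine position is fixed
    by the matrix [T] of largest determinant such that [YT] lies in the unit ball;
    first-order optimality gives [tr A <= n * max_(w in YT) w A w^T] for every
    [A]. This has two consequences: every [z] in [L T^-T] has [|z|^2 <= n], and
    the Dvoretzky-Rogers argument yields [w_1, ..., w_n] in [YT] whose
    determinant is at least [c^n] and which, after a choice of signs, satisfy
    [|w_1 + ... + w_n|^2 <= n]. Hence [g = (w_1 + ... + w_n) / (n + 1)] lies in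
    [YT], and so do the [n + 1] vectors [(w_i - g) / 2] and [- g / 2], whose sum
    is zero. A simplex whose facet normals, normalised at [b], sum to zero has
    barycenter [b]; with [b = bar K] it contains [K], since [<x - b, y>] is the
    average of [<x - z, y> <= 1] over [z] in [K]. Its volume is [det T] up to a
    factor [C^n]. Finally the ellipsoid [{v T^T : |v| <= 1}], hence a
    parallelepiped of volume [det T * (2 / sqrt n)^n], is contained in [K - K],
    whose volume is at most [4^n vol K]. *)
Require Import Defs.
From mathcomp Require Import all_boot all_order all_algebra.
From mathcomp Require Import all_classical all_reals all_analysis.
From mathcomp Require Import measurable_realfun.
From mathcomp Require Import ring lra zify.

Set Implicit Arguments.
Unset Strict Implicit.
Unset Printing Implicit Defensive.

Import Order.TTheory GRing.Theory Num.Theory.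
Import numFieldNormedType.Exports.

Local Open Scope classical_set_scope.
Local Open Scope ring_scope.

(** * Euclidean geometry of row vectors *)

Section dot.
Context {R : realType} {n : nat}.
Implicit Types u v w : 'rV[R]_n.

Definition dot u v : R := (u *m v^T) 0 0.

Lemma dotE u v : dot u v = \sum_i u 0 i * v 0 i.
Proof. by rewrite /dot mxE; apply: eq_bigr => i _; rewrite mxE. Qed.

Lemma mulmx_tr_dot u v : u *m v^T = (dot u v)%:M.
Proof. by rewrite [LHS]mx11_scalar. Qed.

Lemma dotC u v : dot u v = dot v u.
Proof. by rewrite !dotE; apply: eq_bigr => i _; rewrite mulrC. Qed.

Lemma dotDl u v w : dot (u + v) w = dot u w + dot v w.
Proof. by rewrite /dot mulmxDl mxE. Qed.

Lemma dotNl u v : dot (- u) v = - dot u v.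
Proof. by rewrite /dot mulNmx mxE. Qed.

Lemma dotZl a u v : dot (a *: u) v = a * dot u v.
Proof. by rewrite /dot -scalemxAl mxE. Qed.

Lemma dotDr u v w : dot u (v + w) = dot u v + dot u w.
Proof. by rewrite dotC dotDl !(dotC u). Qed.

Lemma dotNr u v : dot u (- v) = - dot u v.
Proof. by rewrite dotC dotNl dotC. Qed.

Lemma dotZr a u v : dot u (a *: v) = a * dot u v.
Proof. by rewrite dotC dotZl dotC. Qed.

Lemma dot0l u : dot 0 u = 0.
Proof. by rewrite /dot mul0mx mxE. Qed.

Lemma dot_suml I (r : seq I) P (F : I -> 'rV[R]_n) v :
  dot (\sum_(i <- r | P i) F i) v = \sum_(i <- r | P i) dot (F i) v.
Proof. by rewrite /dot mulmx_suml summxE. Qed.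

Lemma dot_delta u i : dot u (delta_mx 0 i) = u 0 i.
Proof.
rewrite dotE (bigD1 i)//= mxE !eqxx mulr1 big1 ?addr0// => j ji.
by rewrite mxE eqxx (negbTE ji) mulr0.
Qed.

Lemma dot_ge0 u : 0 <= dot u u.
Proof. by rewrite dotE sumr_ge0// => i _; rewrite -expr2 sqr_ge0. Qed.

Lemma sqr_coord_le_dot u i : u 0 i ^+ 2 <= dot u u.
Proof.
by rewrite dotE (bigD1 i)//= -expr2 lerDl sumr_ge0// => j _; rewrite -expr2 sqr_ge0.
Qed.

Lemma dot_eq0 u : (dot u u == 0) = (u == 0).
Proof.
apply/eqP/eqP => [u0|->]; last exact: dot0l.
apply/rowP => i; rewrite mxE; apply/eqP; rewrite -sqrf_eq0 eq_le sqr_ge0 andbT.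
by rewrite -u0 sqr_coord_le_dot.
Qed.

Lemma dot_gt0 u : u != 0 -> 0 < dot u u.
Proof. by rewrite -dot_eq0 => u0; rewrite lt_def u0 dot_ge0. Qed.

(** The squared norm of [<v,v> u - <u,v> v] is [<v,v>] times the difference of the two sides. *)
Lemma Cauchy_Schwarz_dot u v : dot u v ^+ 2 <= dot u u * dot v v.
Proof.
have [->|v0] := eqVneq v 0; first by rewrite !(dotC _ 0) !dot0l mulr0 expr0n.
have := dot_ge0 (dot v v *: u - dot u v *: v).
rewrite dotDl !dotDr !dotNl !dotNr !dotZl !dotZr (dotC v u).
have := dot_gt0 v0; nra.
Qed.

Lemma dot_le1 u v a b : 0 <= a -> 0 <= b -> dot u u <= a -> dot v v <= b ->
  a * b <= 1 -> dot u v <= 1.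
Proof.
move=> a0 b0 ua vb ab; rewrite (le_trans (ler_norm _))// -ler_sqr ?nnegrE//.
rewrite -normrX expr1n ger0_norm ?sqr_ge0// (le_trans (Cauchy_Schwarz_dot _ _))//.
by rewrite (le_trans _ ab)// ler_pM ?dot_ge0.
Qed.

End dot.

Lemma dot_mulmx {R : realType} m n (u : 'rV[R]_m) (v : 'rV[R]_n) (A : 'M[R]_(m, n)) :
  dot (u *m A) v = dot u (v *m A^T).
Proof. by rewrite /dot trmx_mul trmxK mulmxA. Qed.

(** * Continuity and compactness in spaces of matrices *)

Section continuity.
Context {R : realType}.

Lemma continuous_mx (T : topologicalType) m n (f : T -> 'M[R]_(m, n)) :
  (forall i j, continuous (fun x => f x i j)) -> continuous f.
Proof.
move=> cf x A [P Pfx PA]; rewrite /nbhs/=.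
suff : \forall t \near x, forall i j, P i j (f t i j).
  by apply: filterS => t Pt; apply: PA.
apply: (@filter_forall _ _ (fun i t => forall j, P i j (f t i j)) _ (nbhs_filter x)) => i.
apply: (@filter_forall _ _ (fun j t => P i j (f t i j)) _ (nbhs_filter x)) => j.
exact: cf (Pfx i j).
Qed.

Lemma closed_preimage {S T : topologicalType} (f : S -> T) (D : set T) :
  continuous f -> closed D -> closed (f @^-1` D).
Proof. by move=> cf; apply: preimage_closed => x _; exact: cf. Qed.

Lemma continuous_sum {T : topologicalType} I (r : seq I) (P : pred I) (F : I -> T -> R) :
  (forall i, P i -> continuous (F i)) ->
  continuous (fun x => \sum_(i <- r | P i) F i x).
Proof. by move=> cF; apply: continuous_big => //; exact: add_continuous. Qed.

Lemma continuous_prod {T : topologicalType} I (r : seq I) (P : pred I) (F : I -> T -> R) :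
  (forall i, P i -> continuous (F i)) ->
  continuous (fun x => \prod_(i <- r | P i) F i x).
Proof. by move=> cF; apply: continuous_big => //; exact: mul_continuous. Qed.

Lemma continuous_coord (T : topologicalType) m n (f : T -> 'M[R]_(m, n)) i j :
  continuous f -> continuous (fun x => f x i j).
Proof.
by move=> cf x; exact: (continuous_comp (cf x) (@coord_continuous R m n i j (f x))).
Qed.

Lemma continuous_mulmx (T : topologicalType) m n p (f : T -> 'M[R]_(m, n))
    (g : T -> 'M[R]_(n, p)) :
  continuous f -> continuous g -> continuous (fun x => f x *m g x).
Proof.
move=> cf cg; apply: continuous_mx => i j.
rewrite (_ : (fun _ => _) = fun x => \sum_k f x i k * g x k j); last first.
  by apply/funext => x; rewrite mxE.
apply: continuous_sum => k _ x.
by apply: continuousM; apply: continuous_coord.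
Qed.

Lemma continuous_addmx (T : topologicalType) m n (f g : T -> 'M[R]_(m, n)) :
  continuous f -> continuous g -> continuous (fun x => f x + g x).
Proof.
move=> cf cg; apply: continuous_mx => i j.
rewrite (_ : (fun _ => _) = fun x => f x i j + g x i j); last first.
  by apply/funext => x; rewrite mxE.
by move=> x; apply: continuousD; apply: continuous_coord.
Qed.

Lemma continuous_dot (T : topologicalType) n (f g : T -> 'rV[R]_n) :
  continuous f -> continuous g -> continuous (fun x => dot (f x) (g x)).
Proof.
move=> cf cg; rewrite (_ : (fun _ => _) = fun x => \sum_k f x 0 k * g x 0 k); last first.
  by apply/funext => x; rewrite dotE.
apply: continuous_sum => k _ x.
by apply: continuousM; apply: continuous_coord.
Qed.

Lemma continuous_det (T : topologicalType) n (f : T -> 'M[R]_n) :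
  continuous f -> continuous (fun x => \det (f x)).
Proof.
move=> cf; rewrite /determinant; apply: continuous_sum => s _ x.
apply: cvgM; first exact: cvg_cst.
by apply: continuous_prod => i _; exact: continuous_coord.
Qed.

Lemma le_normrV n (x : 'rV[R]_n) M : 0 <= M ->
  (forall i, `|x 0 i| <= M) -> `|x| <= M.
Proof.
move=> M0 xM; rewrite /Num.norm /= mx_normrE; apply/bigmax_leP; split => //= -[i j] _ /=.
by rewrite ord1.
Qed.

Lemma ler_norm_coord n (x : 'rV[R]_n) i : `|x 0 i| <= `|x|.
Proof.
rewrite [leRHS]/Num.norm /= mx_normrE; apply/bigmax_geP; right => /=.
by exists (0, i).
Qed.

(** Transported from row vectors: [A] is the image under the continuous map [vec_mx] of a bounded
    closed set. *)
Lemma bounded_closed_compact_mx m n (A : set 'M[R]_(m, n)) (M : R) :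
  (forall x, A x -> forall i j, `|x i j| <= M) -> closed A -> compact A.
Proof.
move=> AM cA; have cv : continuous (vec_mx : 'rV[R]_(m * n) -> 'M[R]_(m, n)).
  apply: continuous_mx => i j.
  rewrite (_ : (fun _ => _) = fun x : 'rV[R]_(m * n) => x 0 (mxvec_index i j)).
    exact: coord_continuous.
  by apply/funext => x; rewrite mxE.
have -> : A = vec_mx @` [set v | A (vec_mx v)].
  by apply/seteqP; split => [x Ax|_ [v /= Av <-]//]; exists (mxvec x); rewrite /= mxvecK.
apply: continuous_compact; first exact: continuous_subspaceT.
apply: bounded_closed_compact; last exact: closed_preimage.
exists `|M|; split => // N MN v /= Av; apply: le_normrV; first by rewrite ltW// (le_lt_trans _ MN).
move=> i; rewrite -(vec_mxK v); case/mxvec_indexP: i => i j; rewrite mxvecE.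
by rewrite (le_trans (AM _ Av _ _))// ltW// (le_lt_trans (ler_norm _)).
Qed.

End continuity.

(** * The optimal ellipsoid *)

Section trace_det.
Context {R : realType}.

Lemma horner_char_poly n (B : 'M[R]_n) (x : R) :
  (char_poly B).[x] = \det (x%:M - B).
Proof.
rewrite -[LHS]/(horner_eval x _) -det_map_mx; congr (\det _).
apply/matrixP => i j; rewrite !mxE. rewrite /= /horner_eval !hornerE.
by rewrite hornerMn hornerX.
Qed.

(** For [t != 0] and [n > 0], [det(1 + tB)] is [(-t)^n] times the characteristic polynomial at
    [-1/t]. Its two leading coefficients give [1] and [t tr B]; each other coefficient comes with a
    power of [t] of exponent at least 2, hence at most [t^2] on [[0, 1]]. *)
Lemma det_add1_ge n (B : 'M[R]_n) : exists c : R, forall t, 0 <= t <= 1 ->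
  1 + t * \tr B - c * t ^+ 2 <= \det (1%:M + t *: B).
Proof.
case: n B => [|m] B; first by exists 0 => t _; rewrite det_mx00 [\tr B]big_ord0; lra.
exists (\sum_(i < m) `|(char_poly B)`_i|) => t /andP[t0 t1].
have [->|tn0] := eqVneq t 0.
  by rewrite scale0r addr0 det1; lra.
have -> : 1%:M + t *: B = - t *: ((- t^-1)%:M - B).
  rewrite scalerBr scale_scalar_mx mulrNN divff// scaleNr opprK.
  by [].
rewrite detZ -horner_char_poly horner_coef size_char_poly !big_ord_recr/=.
have -> : (char_poly B)`_m.+1 = 1.
  by have /monicP := char_poly_monic B; rewrite /lead_coef size_char_poly.
rewrite (@char_poly_trace _ m.+1)//= mul1r !mulrDr.
have Et : (- t) ^+ m.+1 * (- t^-1) ^+ m.+1 = 1.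
  by rewrite -exprMn mulrNN divff// expr1n.
have Et2 : (- t) ^+ m.+1 * (- \tr B * (- t^-1) ^+ m) = t * \tr B.
  rewrite exprS mulrACA -!mulrA -exprMn mulrNN divff// expr1n mulr1; ring.
rewrite Et Et2; set C := \sum_(i < m) `|_|; set S := _ * \sum_(i < m) _.
suff : - (C * t ^+ 2) <= S by lra.
rewrite lerNl /S /C mulr_sumr mulr_suml -sumrN ler_sum// => i _.
rewrite (le_trans (ler_norm _))// normrN !normrM !normrX !normrN mulrCA.
rewrite normfV (ger0_norm t0) ler_wpM2l//.
have -> : t ^+ m.+1 = t ^+ (m - i.+1) * t ^+ 2 * t ^+ i.
  by rewrite -!exprD; congr (_ ^+ _); have := ltn_ord i; lia.
rewrite -[_ * t ^+ i * _]mulrA -[t ^+ i * _]exprMn divff// expr1n mulr1.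
by rewrite ler_piMl ?sqr_ge0// exprn_ile1.
Qed.

End trace_det.

Section loewner.
Context {R : realType} {n : nat}.

(** Cauchy-Schwarz on each column of [B]; the trace is the squared Hilbert-Schmidt norm of [B]. *)
Lemma dot_mulmx_le (w : 'rV[R]_n) (B : 'M[R]_n) :
  dot (w *m B) (w *m B) <= dot w w * \tr (B^T *m B).
Proof.
rewrite dotE /mxtrace mulr_sumr; apply: ler_sum => j _.
have -> : (w *m B) 0 j = dot w (row j B^T).
  by rewrite dotE mxE; apply: eq_bigr => k _; rewrite !mxE.
have -> : (B^T *m B) j j = dot (row j B^T) (row j B^T).
  by rewrite dotE mxE; apply: eq_bigr => k _; rewrite !mxE.
by rewrite -expr2 Cauchy_Schwarz_dot.
Qed.

(* The ellipsoid of smallest volume containing [Y] is [{y | |yT| <= 1}] for the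
   [T] of largest determinant; the last clause is the first-order optimality
   condition for the perturbations [T (1 + t B)]. *)
Lemma loewner_position (Y : set 'rV[R]_n) (r rho : R) : 0 < r -> 0 < rho ->
    (forall y, Y y -> dot y y <= r) ->
    (forall i, Y (rho *: delta_mx 0 i)) ->
  exists T : 'M[R]_n, [/\ 0 < \det T,
    forall y, Y y -> dot (y *m T) (y *m T) <= 1 &
    forall (A : 'M[R]_n) s,
      (forall y, Y y -> dot (y *m T *m A) (y *m T) <= s) -> \tr A <= s * n%:R].
Proof.
move=> r0 rho0 Yr Yrho.
pose F : set 'M[R]_n := [set T | forall y, Y y -> dot (y *m T) (y *m T) <= 1].
(* The multiples of the basis vectors in [Y] bound every entry of [T] by [rho^-1]. *)
have cF : compact F.
  apply: (@bounded_closed_compact_mx _ _ _ _ rho^-1) => [T FT i j|].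
    have := FT _ (Yrho i); have := sqr_coord_le_dot (rho *: delta_mx 0 i *m T) j.
    move=> /le_trans/[apply]; rewrite -scalemxAl -rowE !mxE => h.
    have : `|rho * T i j| <= 1.
      by rewrite -(@expr_le1 _ 2)// -normrX ger0_norm ?sqr_ge0.
    by rewrite normrM gtr0_norm// -ler_pdivlMl// mulr1.
  have -> : F = \bigcap_(y in Y)
      (fun T => dot (y *m T) (y *m T)) @^-1` `]-oo, 1]%classic.
    by apply/seteqP; split => T /= FT y Yy; have := FT y Yy; rewrite /= in_itv.
  apply: closed_bigI => y Yy; apply: closed_preimage.
    by apply: continuous_dot; apply: continuous_mulmx => x;
      [exact: cst_continuous|exact: cvg_id|exact: cst_continuous|exact: cvg_id].
  exact: lray_closed.
(* Boundedness of [Y] puts a positive scalar matrix in [F], so the maximal determinant is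
   positive. *)
have Fc : F ((Num.sqrt r)^-1)%:M.
  move=> y Yy; rewrite mul_mx_scalar dotZl dotZr mulrA -invfM -expr2.
  by rewrite (sqr_sqrtr (ltW r0)) ler_pdivrMl// mulr1 Yr.
have [|T FT maxT] := compact_EVT_max (f := fun T : 'M[R]_n => \det T) (ex_intro _ _ Fc) cF.
  by apply: continuous_subspaceT; apply: continuous_det => x; exact: cvg_id.
rewrite inE in FT.
have T0 : 0 < \det T.
  apply: lt_le_trans (maxT _ (mem_set Fc)).
  by rewrite det_scalar exprn_gt0// invr_gt0 sqrtr_gt0.
exists T; split => // A s As; rewrite leNgt; apply/negP => sA.
(* The excess of [tr A] is spread so that [B] keeps the positive trace [sg], while
   [<wB, w> <= s - (s + sg)|w|^2] on [YT]. For small [t], [T(1 + tB)] then stays in [F] and has a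
   larger determinant. *)
pose sg := (\tr A - s * n%:R) / n.+1%:R.
have sg0 : 0 < sg by rewrite divr_gt0// subr_gt0.
pose B := A - (s + sg)%:M.
have trB : \tr B = sg.
  rewrite raddfB/= mxtrace_scalar -mulr_natr mulrDl opprD addrA.
  have -> : \tr A - s * n%:R = sg * n.+1%:R by rewrite divfK.
  by rewrite -natr1; ring.
have [c detB] := det_add1_ge B.
pose C := \tr (B^T *m B).
have C0 : 0 <= C.
  rewrite /C /mxtrace sumr_ge0// => j _; rewrite mxE sumr_ge0// => k _.
  by rewrite mxE -expr2 sqr_ge0.
(* [t = 1/k] has to satisfy [t <= 1] and the bounds [ts], [tC] and [tc]; each summand of [k] serves
   one of them. *)
pose k := 1 + `|s + sg| * 2 + C / sg + `|c| / sg.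
have sc0 : 0 <= `|s + sg| * 2 by rewrite mulr_ge0.
have Csg0 : 0 <= C / sg by rewrite divr_ge0// ltW.
have csg0 : 0 <= `|c| / sg by rewrite divr_ge0// ltW.
have k0 : 0 < k by rewrite /k; lra.
pose t := k^-1.
have t0 : 0 < t by rewrite invr_gt0.
have tk x : x <= k -> t * x <= 1 by move=> xk; rewrite mulrC ler_pdivrMr// mul1r.
have t1 : t <= 1 by rewrite -[t]mulr1 tk// /k; lra.
have ts : t * (2 * (s + sg)) <= 1.
  by apply: tk; have := ler_norm (s + sg); rewrite /k; lra.
have tC : t * C <= sg.
  by rewrite -[leRHS]mul1r -ler_pdivrMr// -mulrA tk// /k; lra.
have tc : t * c < sg.
  rewrite -[ltRHS]mul1r -ltr_pdivrMr// -mulrA mulrC ltr_pdivrMr// mul1r.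
  have : c / sg <= `|c| / sg by rewrite ler_pM2r ?invr_gt0 ?ler_norm.
  by rewrite /k; lra.
(* In the expansion of the squared norm the coefficient [1 - 2t(s + sg)] of [|w|^2] is nonnegative
   by [ts], so the worst case is [|w| = 1], where the bound is [1 - t sg]. *)
have FT' : F (T *m (1%:M + t *: B)).
  move=> y Yy; rewrite mulmxA mulmxDr mulmx1 -scalemxAr; set w := y *m T.
  rewrite dotDl !dotDr !dotZl !dotZr (dotC w (w *m B)).
  have w1 : dot w w <= 1 by exact: FT.
  have wB : dot (w *m B) w <= s - (s + sg) * dot w w.
    by rewrite mulmxBr mul_mx_scalar dotDl dotNl dotZl lerD2r As.
  have wBB : dot (w *m B) (w *m B) <= C.
    by apply: (le_trans (dot_mulmx_le _ _)); rewrite ler_piMl.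
  have h1 : t * dot (w *m B) w <= t * (s - (s + sg) * dot w w) by rewrite ler_pM2l.
  have h2 : t * (t * dot (w *m B) (w *m B)) <= t * sg.
    by rewrite ler_pM2l// (le_trans _ tC)// ler_pM2l.
  have h3 : 0 <= (1 - t * (2 * (s + sg))) * (1 - dot w w).
    by rewrite mulr_ge0// subr_ge0.
  have h4 : 0 <= t * sg by rewrite mulr_ge0 ?ltW.
  lra.
have := maxT _ (mem_set FT'); rewrite det_mulmx ger_pMr// leNgt => /negP; apply.
apply: lt_le_trans (detB t _); last by rewrite ltW.
have : 0 < t * (sg - t * c) by rewrite mulr_gt0// subr_gt0.
by rewrite trB; lra.
Qed.

End loewner.

(** * Separation and the Dvoretzky-Rogers lemma *)

Section bipolar.
Context {R : realType} {n : nat}.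

(** [convex_set] takes its weight in a type of numbers of [[0, 1]]; this lemma and the next pass to
    a real weight with two inequalities. *)
Lemma convex_set_segment (A : set 'rV[R]_n) x y t : convex_set A -> A x -> A y ->
  0 <= t -> t <= 1 -> A (t *: x + (1 - t) *: y).
Proof.
move=> cA Ax Ay t0 t1.
have t01 : Itv.spec (@Itv.num_sem R) (Itv.Real `[0%Z, 1%Z]) t.
  by rewrite /Itv.spec/= /Itv.num_sem/= num_real/= in_itv/= t0 t1.
have := cA x y (Itv.mk t01); rewrite !inE => /(_ Ax Ay); exact.
Qed.

Lemma segment_convex_set (A : set 'rV[R]_n) :
  (forall x y t, A x -> A y -> 0 <= t -> t <= 1 -> A (t *: x + (1 - t) *: y)) ->
  convex_set A.
Proof.
by move=> h x y t; rewrite !inE => Ax Ay; apply: h.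
Qed.

(** If the point [p] of [L] nearest to [x] is not [x], then [w = x - p] separates [x] from [L], and
    a suitable multiple of [w] contradicts the hypothesis on [x]. *)
Lemma bipolar (L : set 'rV[R]_n) x : compact L -> convex_set L -> L 0 ->
  (forall y, (forall z, L z -> dot z y <= 1) -> dot x y <= 1) -> L x.
Proof.
move=> cL cvL L0 xL.
have [||p Lp pmin] := @compact_EVT_min _ R (fun z : 'rV[R]_n => dot (z - x) (z - x)) L _ cL.
- by exists 0.
- apply: continuous_subspaceT; apply: continuous_dot; apply: continuous_addmx => z;
    by [exact: cvg_id|exact: cst_continuous].
rewrite inE in Lp.
have [<-//|px] := eqVneq p x.
pose w := x - p.
have w0 : 0 < dot w w by rewrite dot_gt0// subr_eq0 eq_sym.
have wL z : L z -> dot z w <= dot p w.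
  move=> Lz; rewrite leNgt; apply/negP => zp.
  pose d := z - p; pose e := dot d w; pose q := dot d d.
  have e0 : 0 < e by rewrite /e /d dotDl dotNl subr_gt0.
  have q0 : 0 <= q by exact: dot_ge0.
  (* Moving from [p] towards [z] by this fraction changes the squared distance to [x] from [|w|^2]
     to [|w|^2 - le - l^2 e], against the choice of [p]. *)
  pose l := e / (e + q).
  have eq0 : 0 < e + q by lra.
  have l0 : 0 < l by rewrite divr_gt0.
  have lE : l * (e + q) = e by rewrite divfK// gt_eqF.
  have l1 : l <= 1 by rewrite ler_pdivrMr// mul1r; lra.
  have := pmin _ (mem_set (convex_set_segment cvL Lz Lp (ltW l0) l1)).
  have -> : l *: z + (1 - l) *: p - x = l *: d - w.
    by apply/rowP => i; rewrite !mxE; ring.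
  have -> : p - x = - w by rewrite /w opprB.
  rewrite dotDl !dotDr !dotNl !dotNr !dotZl !dotZr (dotC w d) -/e -/q.
  have : l * (l * (e + q)) = l * e by rewrite lE.
  have : 0 < l * e by rewrite mulr_gt0.
  have : 0 < l * l * e by rewrite -mulrA !(mulr_gt0 l0).
  rewrite !mulrDr !mulrA. lra.
have pw0 : 0 <= dot p w by have := wL 0 L0; rewrite dot0l.
(* The threshold lies halfway between [<p, w>] and [<x, w>]; it is positive even when [<p, w> = 0],
   so [w] can be divided by it. *)
have c0 : 0 < dot p w + dot w w / 2 by lra.
have : dot x ((dot p w + dot w w / 2)^-1 *: w) <= 1.
  by apply: xL => z Lz; rewrite dotZr ler_pdivrMl// mulr1 (le_trans (wL _ Lz))//; lra.
rewrite dotZr ler_pdivrMl// mulr1.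
have -> : dot x w = dot p w + dot w w.
  by rewrite -dotDl; congr (dot _ w); rewrite /w addrC subrK.
lra.
Qed.

End bipolar.

Section gram.
Context {R : realType} {n : nat}.

(** Block elimination (Schur complement). The second factor is the squared distance from [w] to the
    row space of [W], since the matrix in it is the orthogonal projection onto the complement of
    that space. *)
Lemma det_gram_col_mx k (W : 'M[R]_(k, n)) (w : 'rV[R]_n) :
  W *m W^T \in unitmx ->
  \det (col_mx w W *m (col_mx w W)^T) =
  \det (W *m W^T) * dot (w *m (1%:M - W^T *m invmx (W *m W^T) *m W)) w.
Proof.
set G := W *m W^T => uG.
pose b := w *m W^T.
have -> : col_mx w W *m (col_mx w W)^T =
    block_mx 1%:M (b *m invmx G) 0 1%:M *m
    block_mx (w *m w^T - b *m invmx G *m b^T) 0 b^T G.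
  rewrite tr_col_mx mul_col_row mulmx_block !mul1mx !mul0mx !add0r.
  by rewrite subrK mulmxKV// trmx_mul trmxK.
rewrite det_mulmx det_ublock !det1 !mul1r det_lblock mulrC; congr (_ * _).
rewrite [X in \det X]mx11_scalar det_scalar1 /dot mulmxBr mulmxBl mulmx1.
by rewrite /b trmx_mul trmxK !mulmxA.
Qed.

Lemma trace_gram_proj k (W : 'M[R]_(k, n)) : W *m W^T \in unitmx ->
  \tr (1%:M - W^T *m invmx (W *m W^T) *m W) = n%:R - k%:R.
Proof.
by move=> uG; rewrite raddfB/= mxtrace1 mxtrace_mulC mulmxA mulmxV// mxtrace1.
Qed.

(* The Dvoretzky-Rogers argument, run on Gram determinants; the sign of each new
   vector is chosen so that the sum of the vectors stays short. *)
Lemma dvoretzky_rogers (Y : set 'rV[R]_n) :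
    (forall w, Y w -> Y (- w)) -> (forall w, Y w -> dot w w <= 1) ->
    (forall (A : 'M[R]_n) s, (forall w, Y w -> dot (w *m A) w <= s) ->
      \tr A <= s * n%:R) ->
  forall k, (k <= n)%N -> exists W : 'M[R]_(k, n),
    [/\ forall i, Y (row i W),
        \prod_(i < k) ((n - i)%:R / (2 * n%:R)) <= \det (W *m W^T) &
        dot (\sum_i row i W) (\sum_i row i W) <= k%:R].
Proof.
move=> Ysym Y1 Ytr; elim=> [_|k IH kn].
  exists 0; split; first by case.
  - by rewrite big_ord0 det_mx00.
  - by rewrite big_ord0 dot0l.
have [W [YW detW sumW]] := IH (ltnW kn).
have n0 : 0 < n%:R :> R by rewrite ltr0n (leq_trans _ kn).
have detW0 : 0 < \det (W *m W^T).
  apply: lt_le_trans detW; rewrite prodr_gt0// => i _.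
  by rewrite divr_gt0 ?mulr_gt0// ltr0n subn_gt0 (ltn_trans _ kn).
have uW : W *m W^T \in unitmx by rewrite unitmxE unitfE gt_eqF.
pose A := 1%:M - W^T *m invmx (W *m W^T) *m W.
have trA : \tr A = (n - k)%:R by rewrite trace_gram_proj// natrB// ltnW.
have nk0 : 0 < (n - k)%:R :> R by rewrite ltr0n subn_gt0.
(* Otherwise the trace hypothesis, applied to [A], would give [n - k <= (n - k) / 2]. *)
have [w Yw wA] : exists2 w, Y w & (n - k)%:R / (2 * n%:R) < dot (w *m A) w.
  apply: contrapT => h; have := Ytr A ((n - k)%:R / (2 * n%:R)).
  rewrite trA => /(_ _)/wrap[].
    by move=> w Yw; rewrite leNgt; apply/negP => wA; apply: h; exists w.
  have -> : (n - k)%:R / (2 * n%:R) * n%:R = (n - k)%:R / 2 :> R.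
    by field; rewrite gt_eqF.
  by rewrite leNgt => /negP; apply; lra.
wlog ws : w Yw wA / dot w (\sum_i row i W) <= 0 => [h|].
  have [|/ltW] := leP (dot w (\sum_i row i W)) 0; first exact: h.
  move=> ws; apply: (h (- w)); first exact: Ysym.
  - by rewrite mulNmx dotNl dotNr opprK.
  - by rewrite dotNl oppr_le0.
have row0 : row (0 : 'I_(1 + k)) (col_mx w W) = w.
  have -> : (0 : 'I_(1 + k)) = lshift k 0 by exact: val_inj.
  by rewrite rowKu row_id.
have rowS i : row (lift (0 : 'I_(1 + k)) i) (col_mx w W) = row i W.
  have -> : lift (0 : 'I_(1 + k)) i = rshift 1 i by exact: val_inj.
  by rewrite rowKd.
exists (col_mx w W); split.
- by move=> i; case: (unliftP 0 i) => [j|] ->; rewrite ?row0 ?rowS.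
- rewrite (det_gram_col_mx w uW) big_ord_recr/= ler_pM ?prodr_ge0 ?divr_ge0 ?mulr_ge0//.
  by rewrite ltW.
- rewrite big_ord_recl row0; under eq_bigr do rewrite rowS.
  move: sumW ws; set s := \sum_i _ => sumW ws.
  rewrite dotDl !dotDr (dotC s w) -addn1 natrD; have := Y1 _ Yw; lra.
Qed.

End gram.

(** * Lebesgue measure under affine maps *)

Section lebesgue_affine.
Context {R : realType}.
Local Notation leb := (@lebesgue_measure R).

(** By uniqueness of Lebesgue measure it suffices to compare on half-open intervals. *)
Lemma lebesgue_measure_affine (a b : R) (A : set (measurableTypeR R)) :
  a != 0 -> measurable A ->
  leb ((fun x => a * x + b) @^-1` A) = (`|a|^-1%:E * leb A)%E.
Proof.
move=> a0 mA; pose f (x : measurableTypeR R) : measurableTypeR R := a * x + b.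
have mf : measurable_fun setT f.
  by apply: measurable_funD => //; exact: measurable_funM.
have na0 : 0 < `|a| by rewrite normr_gt0.
pose nu := [the {measure set _ -> \bar R} of pushforward leb f].
pose r : {nonneg R} := NngNum (normr_ge0 a).
have mE : forall B, measurable B -> leb B = mscale r (nu mf) B.
  apply: lebesgue_measure_unique => //= _ [[x y] _ <-].
  rewrite /mscale /= /pushforward.
  (* A negative slope turns left-open intervals into right-open ones. *)
  case/orP: (lt_total a0) => a0'.
    have -> : f @^-1` `]x, y] = `[(y - b) / a, (x - b) / a[%classic.
      apply/seteqP; split => z; rewrite /f /= !in_itv/=;
        rewrite ler_ndivrMr// ltr_ndivlMr// => /andP[h1 h2]; apply/andP; split; lra.
    rewrite !lebesgue_measure_itv/= !lte_fin.
    rewrite ltr_ndivlMr// divfK// ltrD2r.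
    case: ifP => _; last by rewrite mule0.
    rewrite -!EFinD -EFinM ltr0_norm//; congr (_%:E); field; exact: a0.
  have -> : f @^-1` `]x, y] = `](x - b) / a, (y - b) / a]%classic.
    apply/seteqP; split => z; rewrite /f /= !in_itv/=;
      rewrite ler_pdivlMr// ltr_pdivrMr// => /andP[h1 h2]; apply/andP; split; lra.
  rewrite !lebesgue_measure_itv/= !lte_fin.
  rewrite ltr_pdivrMr// divfK// ltrD2r.
  case: ifP => _; last by rewrite mule0.
  rewrite -!EFinD -EFinM gtr0_norm//; congr (_%:E); field; exact: a0.
by rewrite (mE A mA) /mscale/= muleA -EFinM mulVf ?gt_eqF// mul1e.
Qed.

End lebesgue_affine.

(** * Change of variables for translations and invertible matrices *)

Section linear_change.
Context {R : realType}.
Local Notation leb := (@lebesgue_measure R).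

Lemma measurable_mulmx m n p (A : 'M[R]_(n, p)) :
  measurable_fun setT (fun x : 'M[R]_(m, n) => x *m A).
Proof.
apply/measurable_fun_mxP => i j; under eq_fun do rewrite mxE.
by apply: measurable_sum => k; apply: measurable_funM => //; exact: measurable_coord_mx.
Qed.

Lemma measurable_addmx d (T : measurableType d) m n (f g : T -> 'M[R]_(m, n)) :
  measurable_fun setT f -> measurable_fun setT g ->
  measurable_fun setT (fun x => f x + g x).
Proof.
move=> /measurable_fun_mxP mf /measurable_fun_mxP mg.
apply/measurable_fun_mxP => i j; under eq_fun do rewrite mxE.
by apply: measurable_funD; [exact: mf|exact: mg].
Qed.

Lemma measurable_preimageT d d' (S : measurableType d) (T : measurableType d')
    (f : S -> T) A : measurable_fun setT f -> measurable A -> measurable (f @^-1` A).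
Proof. by move=> mf mA; rewrite -[X in measurable X]setTI; exact: mf. Qed.

Lemma uncons_rVK n : cancel (@uncons_rV R n) (@cons_rV R n).
Proof.
move=> v; apply/rowP => i; case: (unliftP 0 i) => [j|] ->.
  by rewrite cons_rVS mxE.
by rewrite cons_rV0.
Qed.

Lemma lebesgue_rV_fiber1 n (A : set 'rV[R]_n.+1) :
  lebesgue_rV A = (\int[leb]_x lebesgue_rV [set v | A (cons_rV (x, v))])%E.
Proof.
apply: eq_integral => x _; congr (lebesgue_rV _).
by apply/seteqP; split => v /=; rewrite /xsection/= inE.
Qed.

(** Tonelli: the two iterated product measures agree on rectangles, hence on all measurable sets. *)
Lemma lebesgue_rV_fiber2 n (A : set 'rV[R]_n.+1) : measurable A ->
  lebesgue_rV A = (\int[@lebesgue_rV R n]_v leb [set x | A (cons_rV (x, v))])%E.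
Proof.
move=> mA; transitivity ((leb \x^ @lebesgue_rV R n)%E (@cons_rV R n @^-1` A)).
  have E X : measurable X -> (leb \x @lebesgue_rV R n)%E X = (leb \x^ @lebesgue_rV R n)%E X.
    by apply: product_measure_unique => B C mB mC; exact: product_measure2E.
  exact: E (measurable_preimageT (@measurable_cons_rV _ _) mA).
apply: eq_integral => v _; congr (leb _).
by apply/seteqP; split => x /=; rewrite /ysection/= inE.
Qed.

Lemma measurable_fiber1 n (A : set 'rV[R]_n.+1) x : measurable A ->
  measurable [set v | A (cons_rV (x, v))].
Proof.
move=> mA; have := measurable_xsection x (measurable_preimageT (@measurable_cons_rV R n) mA).
by congr measurable; apply/seteqP; split => v /=; rewrite /xsection/= inE.
Qed.

Lemma measurable_fiber2 n (A : set 'rV[R]_n.+1) v : measurable A ->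
  measurable [set x : measurableTypeR R | A (cons_rV (x, v))].
Proof.
move=> mA; have := measurable_ysection v (measurable_preimageT (@measurable_cons_rV R n) mA).
by congr measurable; apply/seteqP; split => x /=; rewrite /ysection/= inE.
Qed.

(** The factor refers to preimages, so multiplication by [M] has the factor [1 / |det M|]. *)
Definition dilates n (c : R) (f : 'rV[R]_n -> 'rV[R]_n) :=
  measurable_fun setT f /\
  forall A, measurable A -> lebesgue_rV (f @^-1` A) = (c%:E * lebesgue_rV A)%E.

Lemma eq_dilates n c d (f g : 'rV[R]_n -> 'rV[R]_n) :
  dilates c f -> c = d -> f =1 g -> dilates d g.
Proof. by move=> cf <- /funext <-. Qed.

Lemma dilates_comp n c d (f g : 'rV[R]_n -> 'rV[R]_n) :
  dilates c f -> dilates d g -> dilates (d * c) (f \o g).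
Proof.
move=> [mf cf] [mg dg]; split; first exact: measurableT_comp.
move=> A mA; rewrite comp_preimage dg; last exact: measurable_preimageT.
by rewrite cf// muleA EFinM.
Qed.

Lemma measurable_fun_fiber1 n (A : set 'rV[R]_n.+1) : measurable A ->
  measurable_fun setT (fun x : measurableTypeR R => lebesgue_rV [set v | A (cons_rV (x, v))]).
Proof.
move=> mA; have := measurable_fun_xsection (@lebesgue_rV R n)
  (measurable_preimageT (@measurable_cons_rV R n) mA).
congr measurable_fun; apply/funext => x; congr (lebesgue_rV _).
by apply/seteqP; split => v /=; rewrite /xsection/= inE.
Qed.

Lemma measurable_fun_fiber2 n (A : set 'rV[R]_n.+1) : measurable A ->
  measurable_fun setT (fun v : 'rV[R]_n => leb [set x | A (cons_rV (x, v))]).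
Proof.
move=> mA; have := measurable_fun_ysection leb
  (measurable_preimageT (@measurable_cons_rV R n) mA).
congr measurable_fun; apply/funext => v; congr (leb _).
by apply/seteqP; split => x /=; rewrite /ysection/= inE.
Qed.

(** A map that fixes the first coordinate acts slice by slice; the slice volumes are integrated. *)
Lemma dilates_fiber1 n c (f : 'rV[R]_n.+1 -> 'rV[R]_n.+1) (g : R -> 'rV[R]_n -> 'rV[R]_n) :
  0 <= c -> measurable_fun setT f ->
  (forall x v, f (cons_rV (x, v)) = cons_rV (x, g x v)) ->
  (forall x, dilates c (g x)) -> dilates c f.
Proof.
move=> c0 mf fE cg; split => // A mA; rewrite !lebesgue_rV_fiber1.
rewrite -ge0_integralZl//; last exact: measurable_fun_fiber1.
apply: eq_integral => x _.
rewrite -(cg x).2; last exact: measurable_fiber1.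
by congr (lebesgue_rV _); apply/seteqP; split => v /=; rewrite fE.
Qed.

(** Every line parallel to the first axis is mapped to itself with slope [a], so the one-dimensional
    case applies on each. *)
Lemma dilates_fiber2 n a (f : 'rV[R]_n.+1 -> 'rV[R]_n.+1) (g : 'rV[R]_n -> R) :
  a != 0 -> measurable_fun setT f ->
  (forall x v, f (cons_rV (x, v)) = cons_rV (a * x + g v, v)) ->
  dilates `|a|^-1 f.
Proof.
move=> a0 mf fE; split => // A mA.
rewrite !lebesgue_rV_fiber2//; last exact: measurable_preimageT.
rewrite -ge0_integralZl//; last exact: measurable_fun_fiber2.
apply: eq_integral => v _.
rewrite -(lebesgue_measure_affine (g v) a0); last exact: measurable_fiber2.
by congr (leb _); apply/seteqP; split => x /=; rewrite fE.
Qed.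

Lemma dilates0 (f : 'rV[R]_0 -> 'rV[R]_0) : dilates 1 f.
Proof.
have -> : f = id by apply/funext => v; apply/rowP => -[].
by split => [|A mA]; [exact: measurable_id|rewrite preimage_id mul1e].
Qed.

Lemma row_cons_rV n x (v : 'rV[R]_n) : cons_rV (x, v) = row_mx x%:M v.
Proof. by []. Qed.

Lemma cons_rVD n x y (u v : 'rV[R]_n) :
  cons_rV (x, u) + cons_rV (y, v) = cons_rV (x + y, u + v).
Proof.
by apply/rowP => i; rewrite mxE; case: (unliftP 0 i) => [j|] ->;
  rewrite ?cons_rVS ?cons_rV0 ?mxE.
Qed.

Lemma dilates_translate n (a : 'rV[R]_n) : dilates 1 (fun x => x + a).
Proof.
elim: n a => [a|n IH a]; first exact: dilates0.
pose x := (uncons_rV a).1; pose u := (uncons_rV a).2.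
have -> : (fun y => y + a) =
    (fun y => y + cons_rV (0, u)) \o (fun y => y + cons_rV (x, 0)).
  apply/funext => y /=; rewrite -addrA cons_rVD addr0 add0r.
  by rewrite (_ : (x, u) = uncons_rV a) ?uncons_rVK.
have mD (b : 'rV[R]_n.+1) : measurable_fun setT (fun y : 'rV[R]_n.+1 => y + b).
  by apply: measurable_addmx; [exact: measurable_id|exact: measurable_cst].
rewrite -(mulr1 1); apply: dilates_comp.
- by apply: (dilates_fiber1 (g := fun _ v => v + u)) => // y v; rewrite cons_rVD addr0.
- rewrite -invr1 -[X in X^-1]normr1.
  apply: (dilates_fiber2 (a := 1) (g := fun=> x)) => //.
  by move=> y v; rewrite cons_rVD addr0 mul1r.
Qed.

(** Induction on the dimension. With a nonzero corner entry the matrix is a block lower triangular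
    factor, treated by [dilates_fiber2], times a block upper triangular one, treated by
    [dilates_fiber1] and the induction hypothesis. *)
Lemma dilates_mulmx n (M : 'M[R]_n) : M \in unitmx ->
  dilates `|\det M|^-1 (fun x => x *m M).
Proof.
elim: n M => [M _|n IH].
  by rewrite det_mx00 normr1 invr1; exact: dilates0.
change (forall M : 'M[R]_(1 + n), M \in unitmx ->
  dilates `|\det M|^-1 (fun x : 'rV[R]_(1 + n) => x *m M)) => M.
have upper (u : 'rV[R]_n) (N : 'M[R]_n) : N \in unitmx ->
    dilates `|\det N|^-1 (fun x : 'rV[R]_(1 + n) => x *m block_mx 1%:M u 0 N).
  move=> uN; apply: (dilates_fiber1 (g := fun x v => v *m N + x *: u)).
  - by rewrite invr_ge0.
  - exact: measurable_mulmx.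
  - move=> x v; rewrite !row_cons_rV mul_row_block mulmx1 mulmx0 addr0.
    by rewrite mul_scalar_mx addrC.
  - move=> x; rewrite -[X in dilates X]mul1r mulrC.
    exact: (dilates_comp (dilates_translate _) (IH _ uN)).
have lower (a : R) (w : 'cV[R]_n) : a != 0 ->
    dilates `|a|^-1 (fun x : 'rV[R]_(1 + n) => x *m block_mx a%:M 0 w 1%:M).
  move=> a0; apply: (dilates_fiber2 (g := fun v => (v *m w) 0 0)) => //.
  - exact: measurable_mulmx.
  - move=> x v; rewrite !row_cons_rV mul_row_block mulmx1 mulmx0 add0r.
    have <- : x%:M *m a%:M + v *m w = (a * x + (v *m w) 0 0)%:M; last by [].
    by apply/matrixP => i j; rewrite -scalar_mxM !ord1 2!mxE eqxx [RHS]mxE eqxx mulrC.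
suff pivot (P : 'M[R]_(1 + n)) : P \in unitmx -> P 0 0 != 0 ->
    dilates `|\det P|^-1 (fun x => x *m P).
  move=> uM; have [M0|] := eqVneq (M 0 0) 0; last exact: pivot.
  (* When the corner entry is zero, a row with nonzero first entry is added to the first row by
     [E e], which has determinant 1 and inverse [E (- e)]. *)
  have [i Mi] : exists i : 'I_n, M (lift 0 i) 0 != 0.
    apply: contrapT => h; move: uM; rewrite unitmxE unitfE (expand_det_col _ 0).
    rewrite big1 ?eqxx// => k _; case: (unliftP 0 k) => [j|] ->; last by rewrite M0 mul0r.
    have [->|Mj] := eqVneq (M (lift 0 j) 0) 0; first by rewrite mul0r.
    by case: h; exists j.
  pose e : 'rV[R]_n := delta_mx 0 i.
  pose E (b : 'rV[R]_n) : 'M[R]_(1 + n) := block_mx 1%:M b 0 1%:M.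
  have detE b : \det (E b) = 1 by rewrite det_ublock !det1 mulr1.
  have EK : E (- e) *m E e = 1%:M.
    by rewrite mulmx_block !mulmx1 !mul1mx !mulmx0 !mul0mx addr0 !add0r subrr -scalar_mx_block.
  apply: (eq_dilates (f := (fun x : 'rV[R]_(1 + n) => x *m (E e *m M)) \o
      (fun x => x *m E (- e)))).
  - apply: dilates_comp; last by apply: upper; exact: unitmx1.
    apply: pivot; first by rewrite unitmxE det_mulmx detE mul1r -unitmxE.
    have -> : (E e *m M) 0 0 = M (lift 0 i) 0; last by [].
    have z0 : (0 : 'I_(1 + n)) = lshift n 0 by exact: val_inj.
    rewrite /E -{1}(submxK M) mulmx_block z0 block_mxEul.
    rewrite mul1mx -rowE !mxE -z0 M0 add0r.
    by congr (M _ _); exact: val_inj.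
  - by rewrite det1 normr1 invr1 mul1r det_mulmx detE mul1r.
  - by move=> x /=; rewrite -mulmxA (mulmxA _ _ M) EK mul1mx.
move=> uP P0; pose a := P 0 0.
(* [N] is the Schur complement of the corner entry [a]. *)
pose u := a^-1 *: ursubmx P; pose w := dlsubmx P; pose N := drsubmx P - w *m u.
have EP : P = block_mx a%:M 0 w 1%:M *m block_mx 1%:M u 0 N.
  rewrite mulmx_block !mulmx1 !mul1mx !mul0mx !addr0 mul_scalar_mx scalerA.
  rewrite divff// scale1r addrC subrK -[LHS]submxK; congr (block_mx _ _ _ _).
  by rewrite [LHS]mx11_scalar !mxE; congr (P _ _)%:M; exact: val_inj.
have detP : \det P = a * \det N.
  by rewrite EP det_mulmx det_lblock det_ublock !det1 det_scalar1 mulr1 mul1r.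
have uN : N \in unitmx.
  by move: uP; rewrite !unitmxE detP unitrM => /andP[].
apply: (eq_dilates (f := (fun x : 'rV[R]_(1 + n) => x *m block_mx 1%:M u 0 N) \o
    (fun x => x *m block_mx a%:M 0 w 1%:M))).
- by apply: dilates_comp; [exact: upper|exact: lower].
- by rewrite detP normrM invfM.
- by move=> x /=; rewrite -mulmxA -EP.
Qed.

End linear_change.

(** * The volume of the difference body *)

Section difference_body.
Context {R : realType} {n : nat}.
Implicit Types (M : 'M[R]_n) (K P : set 'rV[R]_n).

Lemma dilates_affine M (a : 'rV[R]_n) : M \in unitmx ->
  dilates `|\det M|^-1 (fun x => x *m M + a).
Proof.
move=> uM; apply: (eq_dilates (dilates_comp (dilates_translate a) (dilates_mulmx uM))) => //.
by rewrite mulr1.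
Qed.

Lemma dilates_homothety (r : R) (a : 'rV[R]_n) : r != 0 ->
  dilates (`|r| ^- n) (fun x => r *: x + a).
Proof.
move=> r0; have ur : r%:M \in @unitmx R n by rewrite unitmxE det_scalar unitrX// unitfE.
apply: (eq_dilates (dilates_affine a ur)) => [|x]; last by rewrite mul_mx_scalar.
by rewrite det_scalar normrX.
Qed.

(* For [x = (a - b) / 2] the set [K :&: (K + x)] contains the homothetic copy
   [(K + a) / 2]; integrating over [x] bounds the volume of [P / 2]. *)
Lemma difference_body_volume K P : measurable K -> measurable P ->
  convex_set K -> (0 < lebesgue_rV K)%E -> (lebesgue_rV K < +oo)%E ->
  (forall x, P x -> exists a b, [/\ K a, K b & x = a - b]) ->
  (lebesgue_rV P <= (4 ^+ n)%:E * lebesgue_rV K)%E.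
Proof.
move=> mK mP cK K0 Koo PK.
pose mu := @lebesgue_rV R n.
pose P' := [set x : 'rV[R]_n | P (2 *: x + 0)].
have [mf2 df2] := @dilates_homothety 2 0 (lt0r_neq0 (ltr0n _ 2)).
have mP' : measurable P' by exact: measurable_preimageT mf2 mP.
have muP' : mu P' = ((2 ^- n)%:E * mu P)%E by rewrite -(ger0_norm (ler0n R 2)); exact: df2.
(* The pairs [(x, z)] with [x] in [P / 2] and [z] in [K] and [K + x]. Slices at fixed [x] have
   volume at least [2^-n vol K]; slices at fixed [z] lie in [z - K]. *)
pose E := [set p : 'rV[R]_n * 'rV[R]_n | [/\ P' p.1, K p.2 & K (p.2 + (-1) *: p.1)]].
have mE : measurable E.
  have -> : E = (fst @^-1` P') `&` (snd @^-1` K) `&`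
      ((fun p : 'rV[R]_n * 'rV[R]_n => p.2 + p.1 *m (-1)%:M) @^-1` K).
    by apply/seteqP; split => p /=; rewrite mul_mx_scalar; [case|case=> -[]].
  apply: measurableI; first apply: measurableI.
  - exact: measurable_preimageT measurable_fst mP'.
  - exact: measurable_preimageT measurable_snd mK.
  - apply: measurable_preimageT mK; apply: measurable_addmx; first exact: measurable_snd.
    exact: (measurableT_comp (measurable_mulmx _) measurable_fst).
have lower : ((2 ^- n)%:E * mu K * mu P' <= (mu \x mu)%E E)%E.
  rewrite -integral_cst//.
  rewrite [leRHS](_ : _ = \int[mu]_x mu (xsection E x))%E//.
  rewrite integral_mkcond; apply: ge0_le_integral => //.
  - by move=> x _; rewrite erestrict_ge0// => y _; rewrite mule_ge0// lee_fin.
  - by apply/(measurable_restrictT _ _).1 => //; exact: measurable_cst.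
  - exact: measurable_fun_xsection.
  move=> x _; rewrite /patch; case: ifPn => [/set_mem Px|_]; last exact: measure_ge0.
  (* With [2x = a - b], the points [z] and [z - x] are the midpoints of [2z - a] with [a] and with
     [b]. *)
  have [a [b [Ka Kb ab]]] := PK _ Px.
  have [mg dg] := @dilates_homothety 2 (- a) (lt0r_neq0 (ltr0n _ 2)).
  rewrite -(ger0_norm (ler0n R 2)) -dg//; apply: le_measure; rewrite ?inE.
  - exact: measurable_preimageT mg mK.
  - exact: measurable_xsection.
  - move=> z /= Kz; apply/xsectionP; split => //=.
      have := convex_set_segment cK Kz Ka (t := 2^-1) => /(_ ltac:(lra) ltac:(lra)).
      by congr (K _); apply/rowP => i; rewrite !mxE; field.
    have := convex_set_segment cK Kz Kb (t := 2^-1) => /(_ ltac:(lra) ltac:(lra)).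
    congr (K _); apply/rowP => i; have /rowP/(_ i) := ab.
    rewrite !mxE; lra.
have upper : ((mu \x mu)%E E <= mu K * mu K)%E.
  have -> : (mu \x mu)%E E = (mu \x^ mu)%E E.
    by apply: product_measure_unique => // A B mA mB; exact: product_measure2E.
  rewrite -integral_cst//.
  rewrite [leLHS](_ : _ = \int[mu]_z mu (ysection E z))%E//.
  rewrite [leRHS]integral_mkcond; apply: ge0_le_integral => //.
  - exact: measurable_fun_ysection.
  - by apply/(measurable_restrictT _ _).1 => //; exact: measurable_cst.
  move=> z _; rewrite /patch; case: ifPn => [_|/negP Kz].
    have [mg dg] := @dilates_homothety (-1) z (ltac:(by rewrite oppr_eq0 oner_eq0)).
    have <- : mu ((fun x => -1 *: x + z) @^-1` K) = mu K.
      by rewrite [LHS]dg// normrN1 expr1n invr1 mul1e.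
    apply: le_measure; rewrite ?inE.
    - exact: measurable_ysection.
    - exact: measurable_preimageT mg mK.
    - by move=> x /ysectionP[/= _ _]; rewrite addrC.
  have -> : ysection E z = set0; last by rewrite /mu measure0.
  by apply/seteqP; split => // x /ysectionP[/= _ Kz' _]; apply: Kz; rewrite inE.
have := le_trans lower upper.
rewrite muP' -/mu.
have := K0; have := Koo; rewrite -/mu; case: (mu K) => [k| |]//= _.
rewrite lte_fin => k0.
case EP : (mu P) => [p| |].
- rewrite -!EFinM !lee_fin => h; rewrite -(ler_pM2l k0).
  rewrite (le_trans _ (_ : 4 ^+ n * (k * k) <= _))//; last by lra.
  have -> : k * p = 4 ^+ n * (2 ^- n * k * (2 ^- n * p)).
    have -> : 4 = 2 * 2 :> R by lra.
    by rewrite exprMn; field; rewrite expf_neq0.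
  by rewrite ler_pM2l// exprn_gt0.
- by rewrite -EFinM gt0_muley ?gt0_muley// ?lte_fin ?mulr_gt0 ?invr_gt0 ?exprn_gt0.
- by rewrite leNye.
Qed.

End difference_body.

(** * Simplices *)

Section standard_simplex.
Context {R : realType}.
Local Notation leb := (@lebesgue_measure R).

Definition corner_simplex n (s : R) : set 'rV[R]_n :=
  [set x | (forall i, 0 <= x 0 i) /\ \sum_i x 0 i <= s].
Arguments corner_simplex : clear implicits.

Lemma measurable_corner_simplex n s : measurable (corner_simplex n s).
Proof.
rewrite (_ : corner_simplex n s = \big[setI/setT]_(i < n)
    ((fun x : 'rV[R]_n => x 0 i) @^-1` `[0, +oo[) `&`
    ((fun x : 'rV[R]_n => \sum_i x 0 i : measurableTypeR R) @^-1` `]-oo, s])); last first.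
  apply/seteqP; split => x /=; rewrite -bigcap_seq/= in_itv/=.
    by move=> [x0 xs]; split=> // i _; rewrite /= in_itv/= x0.
  move=> [x0 xs]; split=> // i; have := x0 i (mem_index_enum i).
  by rewrite /= in_itv/= andbT.
apply: measurableI; first apply: bigsetI_measurable => i _.
  exact: measurable_preimageT (measurable_coord_mx _ _) (measurable_itv _).
apply: measurable_preimageT (measurable_itv _).
by apply: measurable_sum => i; exact: measurable_coord_mx.
Qed.

(** The antiderivative is [-(s - X)^(n+1) / (n+1)]; the degenerate interval [s = 0] is treated
    apart. *)
Lemma integral_sub_exprn (s : R) n : 0 <= s ->
  (\int[leb]_(x in `[0%R, s]) ((s - x) ^+ n)%:E = (s ^+ n.+1 / n.+1%:R)%:E)%E.
Proof.
rewrite le_eqVlt => /predU1P[<-|s0].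
  by rewrite set_itv1 integral_set1 expr0n mul0r.
pose p : {poly R} := - (n.+1%:R^-1 *: (s%:P - 'X) ^+ n.+1).
have pE x : p^`().[x] = (s - x) ^+ n.
  rewrite /p derivN derivZ deriv_exp derivB derivC derivX sub0r mulN1r mulNrn.
  rewrite hornerN hornerZ hornerN hornerMn horner_exp !hornerE.
  rewrite /= -[X in - (_ * - X)]mulr_natr.
  by field; rewrite ?natr1 ?nat1r pnatr_eq0.
under eq_integral do rewrite -pE.
rewrite (@continuous_FTC2 _ _ (horner p))//.
- rewrite !hornerN !hornerZ !horner_exp !hornerE subrr expr0n/= mulr0 oppr0.
  by rewrite add0e opprK addr0 mulrC.
- by apply: continuous_subspaceT => x; exact: continuous_horner.
- split; first by move=> x _; exact: derivable_horner.
  + by apply: cvg_at_right_filter; exact: continuous_horner.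
  + by apply: cvg_at_left_filter; exact: continuous_horner.
- by move=> x _; rewrite derivE.
Qed.

(** The slice at first coordinate [x] is the corner simplex of size [s - x]; this is why the size is
    a parameter of the induction. *)
Lemma lebesgue_corner_simplex n (s : R) : 0 <= s ->
  lebesgue_rV (corner_simplex n s) = (s ^+ n / n`!%:R)%:E.
Proof.
elim: n s => [|n IH] s s0.
  rewrite expr0 fact0 divr1 /= diracE mem_set//.
  by split; [case|rewrite big_ord0].
rewrite lebesgue_rV_fiber1.
transitivity (\int[leb]_(x in `[0%R, s]) ((n`!%:R^-1)%:E * ((s - x) ^+ n)%:E))%E.
  rewrite [RHS]integral_mkcond; apply: eq_integral => x _; rewrite /patch.
  have cE v : corner_simplex n.+1 s (cons_rV (x, v)) <->
      0 <= x /\ corner_simplex n (s - x) v.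
    have sE : \sum_i cons_rV (x, v) 0 i = x + \sum_i v 0 i.
      rewrite big_ord_recl cons_rV0; congr (_ + _).
      by apply: eq_bigr => i _; rewrite cons_rVS.
    rewrite /corner_simplex /= sE lerBrDl; split=> [[h1 h2]|[h1 [h2 h3]]].
      split; first by have := h1 0; rewrite cons_rV0.
      by split => // i; have := h1 (lift 0 i); rewrite cons_rVS.
    split => // i; case: (unliftP 0 i) => [j|] ->; first by rewrite cons_rVS.
    by rewrite cons_rV0.
  case: ifPn => [|xs].
    rewrite inE/= in_itv/= => /andP[x0 xs].
    rewrite (_ : [set v | _] = corner_simplex n (s - x)).
      by rewrite IH ?subr_ge0// -EFinM mulrC.
    by apply/seteqP; split => v /=; rewrite cE; [case|].
  rewrite (_ : [set v | _] = set0) ?measure0//.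
  apply/seteqP; split => // v /=; rewrite cE => -[x0 [v0 sv]].
  move: xs => /negP; apply; rewrite inE/= in_itv/= x0/= -subr_ge0.
  by rewrite (le_trans _ sv)// sumr_ge0.
rewrite ge0_integralZl//.
- rewrite integral_sub_exprn// -EFinM factS natrM invfM.
  by congr (_%:E); ring.
- apply/measurable_EFinP; apply: measurable_funX; apply: measurable_funB => //.
- by move=> x /=; rewrite in_itv/= => /andP[_ xs]; rewrite lee_fin exprn_ge0// subr_ge0.
Qed.

End standard_simplex.
Arguments corner_simplex {R} n s.

Section convex_combination.
Context {R : realType} {n : nat}.

(** All terms but the first are rescaled by their total weight [t]; if [t = 0] they vanish. *)
Lemma convex_sum (B : set 'rV[R]_n) m (l : 'I_m.+1 -> R) (v : 'I_m.+1 -> 'rV[R]_n) :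
  convex_set B -> (forall i, 0 <= l i) -> \sum_i l i = 1 -> (forall i, B (v i)) ->
  B (\sum_i l i *: v i).
Proof.
move=> cB; elim: m l v => [|m IH] l v l0 l1 Bv.
  by move: l1; rewrite !big_ord1 => ->; rewrite scale1r.
move: l1; rewrite big_ord_recl [in X in _ -> X]big_ord_recl.
set t := \sum_(i < m.+1) l (lift ord0 i) => l1.
have t0 : 0 <= t by exact: sumr_ge0.
have l01 : l ord0 <= 1 by lra.
have [tz|tn0] := eqVneq t 0.
  rewrite big1 ?addr0; first by move: l1; rewrite tz addr0 => ->; rewrite scale1r.
  move=> i _; have /eqP := tz; rewrite psumr_eq0// => /allP/(_ i).
  by rewrite mem_index_enum => /(_ isT)/eqP ->; rewrite scale0r.
have := IH (fun i => l (lift ord0 i) / t) (fun i => v (lift ord0 i)).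
move=> /(_ _ _ _)/wrap[|||Bt].
- by move=> i; rewrite divr_ge0.
- by rewrite -mulr_suml divff.
- by [].
have := convex_set_segment cB (Bv ord0) Bt (l0 ord0) l01.
congr (B (_ + _)); rewrite scaler_sumr; apply: eq_bigr => i _.
by rewrite scalerA (_ : 1 - l ord0 = t) 1?mulrC ?divfK//; lra.
Qed.

End convex_combination.

(** * Simplices whose facet normals sum to zero *)

Section dual_simplex.
Context {R : realType} {n : nat}.
Variables (b : 'rV[R]_n) (F : 'M[R]_n).
Hypothesis uF : F \in unitmx.

(* The normals sum to zero, so that the vertex [v_i] opposite to the facet [i]
   satisfies [<v_i - b, f_j> = 1] for [j != i] and [<v_i - b, f_i> = - n]. *)
Definition facet_normal (i : 'I_n.+1) : 'rV[R]_n :=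
  if unlift ord0 i is Some j then row j F else - \sum_j row j F.

Definition dual_simplex : set 'rV[R]_n :=
  [set x | forall i, dot (x - b) (facet_normal i) <= 1].

Lemma facet_normal0 : facet_normal ord0 = - \sum_j row j F.
Proof. by rewrite /facet_normal unlift_none. Qed.

Lemma facet_normalS j : facet_normal (lift ord0 j) = row j F.
Proof. by rewrite /facet_normal liftK. Qed.

Lemma sum_facet_normal : \sum_i facet_normal i = 0.
Proof.
rewrite big_ord_recl; under eq_bigr do rewrite facet_normalS.
rewrite facet_normal0.
by rewrite addNr.
Qed.

Lemma sum_dot_facet_normal z : \sum_i dot z (facet_normal i) = 0.
Proof.
by under eq_bigr do rewrite dotC; rewrite -dot_suml sum_facet_normal dot0l.
Qed.

Lemma mulmx_tr_coord (z : 'rV[R]_n) j : (z *m F^T) 0 j = dot z (row j F).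
Proof. by rewrite dotE mxE; apply: eq_bigr => k _; rewrite !mxE. Qed.

Let uFT : F^T \in unitmx. Proof. by rewrite unitmx_tr. Qed.

(** The affine map sends [x] to its barycentric coordinates [(1 - <x - b, f_j>) / (n + 1)] other
    than the one of [ord0]. As all of them add up to 1, the inequality of facet [ord0] becomes the
    bound on the coordinate sum. *)
Lemma dual_simplex_preimage : dual_simplex =
  (fun x => x *m (- n.+1%:R^-1 *: F^T) + n.+1%:R^-1 *: (const_mx 1 + b *m F^T))
    @^-1` corner_simplex n 1.
Proof.
have n0 : 0 < n.+1%:R :> R by rewrite ltr0n.
set phi := fun x => _ + _.
have yE x j : phi x 0 j = (1 - dot (x - b) (facet_normal (lift ord0 j))) / n.+1%:R.
  rewrite facet_normalS -mulmx_tr_coord mulmxBl /phi -scalemxAr.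
  rewrite scaleNr addrC -scalerBr !mxE; ring.
have sE x : \sum_j phi x 0 j = 1 - (1 - dot (x - b) (facet_normal ord0)) / n.+1%:R.
  under eq_bigr do rewrite yE.
  rewrite -mulr_suml sumrB sumr_const card_ord.
  have := sum_dot_facet_normal (x - b); rewrite big_ord_recl => h.
  rewrite (_ : \sum_(i < n) _ = - dot (x - b) (facet_normal ord0)); last by lra.
  by rewrite -natr1; field; rewrite natr1 gt_eqF.
apply/seteqP; split => x /=.
- move=> Sx; split => [j|]; first by rewrite yE divr_ge0 ?subr_ge0// ltW.
  by rewrite sE lerBlDr lerDl divr_ge0 ?subr_ge0// ltW.
- move=> [y0 sy] i; rewrite -subr_ge0; case: (unliftP ord0 i) => [j|] ->.
    by have := y0 j; rewrite yE pmulr_lge0// invr_gt0.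
  by move: sy; rewrite sE lerBlDr lerDl pmulr_lge0// invr_gt0.
Qed.

Lemma lebesgue_dual_simplex :
  lebesgue_rV dual_simplex = (n.+1%:R ^+ n / n`!%:R / `|\det F|)%:E.
Proof.
have n0 : n.+1%:R != 0 :> R by rewrite pnatr_eq0.
have u : - n.+1%:R^-1 *: F^T \in unitmx.
  by rewrite unitmxE detZ unitrM -unitmxE uFT andbT unitrX// unitfE oppr_eq0 invr_eq0.
rewrite dual_simplex_preimage (dilates_affine _ u).2; last exact: measurable_corner_simplex.
rewrite lebesgue_corner_simplex// expr1n -EFinM detZ det_tr normrM normrX.
by rewrite normrN (ger0_norm (x := _^-1))// exprVn invfM invrK; congr (_%:E); ring.
Qed.

Definition dual_vertex (i : 'I_n.+1) : 'rV[R]_n :=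
  b + (if unlift ord0 i is Some j then const_mx 1 - n.+1%:R *: delta_mx 0 j
       else const_mx 1) *m invmx F^T.

Lemma dual_vertexE i : (dual_vertex i - b) *m F^T =
  if unlift ord0 i is Some j then const_mx 1 - n.+1%:R *: delta_mx 0 j else const_mx 1.
Proof. by rewrite /dual_vertex addrC addKr mulmxKV. Qed.

(** Used with weights of sum 0 for affine independence and of sum 1 for barycentric coordinates. *)
Lemma sum_dual_vertex (l : 'I_n.+1 -> R) :
  (\sum_i l i *: (dual_vertex i - b)) *m F^T =
  \row_j (\sum_i l i - n.+1%:R * l (lift ord0 j)).
Proof.
rewrite mulmx_suml; under eq_bigr do rewrite -scalemxAl dual_vertexE.
apply/rowP => j; rewrite summxE mxE [in LHS]big_ord_recl unlift_none !mxE mulr1.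
under eq_bigr => i _ do rewrite liftK !mxE eqxx/= mulrBr mulr1.
rewrite sumrB addrA; congr (_ - _); first by rewrite [in RHS]big_ord_recl.
rewrite (bigD1 j)//= eqxx mulr1 big1 ?addr0 1?mulrC// => i ij.
by rewrite eq_sym (negbTE ij) mulr0 mulr0.
Qed.

Lemma dual_vertex_independent : affinely_independent dual_vertex.
Proof.
move=> c c0 cv.
have : (\sum_i c i *: (dual_vertex i - b)) = 0.
  by under eq_bigr do rewrite scalerBr; rewrite sumrB cv -scaler_suml c0 scale0r subr0.
move=> /(congr1 (fun z => z *m F^T)); rewrite sum_dual_vertex c0 mul0mx => /rowP h.
have cS j : c (lift ord0 j) = 0.
  have := h j; rewrite !mxE sub0r => /eqP; rewrite oppr_eq0 mulf_eq0 pnatr_eq0/=.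
  by move/eqP.
move=> i; case: (unliftP ord0 i) => [j|] -> //.
by move: c0; rewrite big_ord_recl big1 ?addr0.
Qed.

(** A point of the simplex is the combination of the vertices with weights
    [(1 - <x - b, f_i>) / (n + 1)]. Conversely, the simplex is convex and contains each vertex. *)
Lemma dual_simplex_hull : dual_simplex = convex_hull (range dual_vertex).
Proof.
have n0 : 0 < n.+1%:R :> R by rewrite ltr0n.
apply/seteqP; split => [x Sx|].
  move=> B [cB vB]; pose l i := (1 - dot (x - b) (facet_normal i)) / n.+1%:R.
  have l1 : \sum_i l i = 1.
    rewrite -mulr_suml sumrB sumr_const card_ord sum_dot_facet_normal subr0.
    by rewrite divff// gt_eqF.
  suff -> : x = \sum_i l i *: dual_vertex i.
    apply: convex_sum => // [i|i]; first by rewrite divr_ge0 ?subr_ge0// ltW.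
    by apply: vB; exists i.
  apply/eqP; rewrite -(subr_eq0 x) -[x](subrK b) -addrA.
  have -> : b - \sum_i l i *: dual_vertex i = - \sum_i l i *: (dual_vertex i - b).
    under [in RHS]eq_bigr do rewrite scalerBr.
    by rewrite sumrB -scaler_suml l1 scale1r opprB.
  rewrite subr_eq0; apply/eqP/(can_inj (mulmxK uFT)).
  rewrite sum_dual_vertex; apply/rowP => j; rewrite mulmx_tr_coord mxE l1.
  by rewrite /l facet_normalS mulrC divfK ?gt_eqF//; ring.
apply: smallest_sub => [|_ [i _ <-]].
  apply: segment_convex_set => x y t Sx Sy t0 t1 i.
  have -> : t *: x + (1 - t) *: y - b = t *: (x - b) + (1 - t) *: (y - b).
    by apply/rowP => k; rewrite !mxE; ring.
  rewrite dotDl !dotZl; have := Sx i; have := Sy i.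
  by nra.
move=> k; have vE j : dot (dual_vertex i - b) (row j F) =
    if i == lift ord0 j then - n%:R else 1.
  rewrite -mulmx_tr_coord dual_vertexE; case: (unliftP ord0 i) => [h|] ->.
    rewrite !mxE eqxx/= (inj_eq lift_inj) eq_sym; case: eqP => _; last by rewrite mulr0 subr0.
    by rewrite mulr1 -natr1; ring.
  by rewrite mxE.
case: (unliftP ord0 k) => [j|] ->.
  by rewrite facet_normalS vE; case: ifP => // _; rewrite (le_trans _ (ler01 _))// oppr_le0.
rewrite facet_normal0 dotNr dotC dot_suml; under eq_bigr do rewrite dotC vE.
case: (unliftP ord0 i) => [h|] ->.
  rewrite (bigD1 h)//= eqxx (eq_bigr (fun=> 1)) => [|j jh]; last first.
    by rewrite (inj_eq lift_inj) eq_sym (negbTE jh).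
  rewrite sumr_const cardC1 card_ord -subn1 natrB; first by lra.
  by case: (n) h => [[]|].
by rewrite sumr_const card_ord (le_trans _ ler01)// oppr_le0.
Qed.

Lemma simplex_dual_simplex : simplex dual_simplex.
Proof.
by exists dual_vertex; [exact: dual_vertex_independent|exact: dual_simplex_hull].
Qed.

End dual_simplex.

(** * Barycenters *)

Section compact_integrals.
Context {R : realType} {n : nat}.
Implicit Types A : set 'rV[R]_n.

Lemma compact_closed_rV A : compact A -> closed A.
Proof. by apply: compact_closed; exact: norm_hausdorff. Qed.

Lemma compact_measurable_rV A : compact A -> measurable A.
Proof.
move=> /compact_closed_rV cA; rewrite -[A]setCK; apply: measurableC.
by apply: open_measurable_mx; exact: closed_openC.
Qed.

Lemma compact_coord_bounded A : compact A ->
  exists2 M : R, 0 < M & forall x, A x -> forall i, `|x 0 i| <= M.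
Proof.
move=> /compact_bounded/ex_strict_bound_gt0[M M0 AM]; exists M => // x Ax i.
by rewrite (le_trans (ler_norm_coord _ _))// ltW// AM.
Qed.

Lemma cube_prod (r : R) : [set v : 'rV[R]_n | forall i, `|v 0 i| <= r] =
  [set v : 'rV[R]_n | forall i, `[- r, r]%classic (v 0 i)].
Proof.
by apply/seteqP; split => v /= vr i; have := vr i; rewrite in_itv/= ler_norml.
Qed.

Lemma lebesgue_cube (r : R) : 0 < r ->
  lebesgue_rV [set v : 'rV[R]_n | forall i, `|v 0 i| <= r] = ((2 * r) ^+ n)%:E.
Proof.
move=> r0; rewrite cube_prod (lebesgue_rV_box (fun _ => measurable_itv _)).
rewrite (eq_bigr (fun=> (2 * r)%:E)); last first.
  move=> i _; rewrite lebesgue_measure_itv/= lte_fin (_ : - r < r); last by lra.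
  by rewrite -EFinD; congr (_%:E); lra.
by rewrite prodEFin prodr_const card_ord.
Qed.

Lemma measurable_cube (r : R) :
  measurable [set v : 'rV[R]_n | forall i, `|v 0 i| <= r].
Proof.
rewrite cube_prod (_ : [set v | _] = \big[setI/setT]_(i < n)
    ((fun v : 'rV[R]_n => v 0 i) @^-1` `[- r, r])).
  apply: bigsetI_measurable => i _.
  exact: measurable_preimageT (measurable_coord_mx _ _) (measurable_itv _).
apply/seteqP; split => v /=; rewrite -bigcap_seq/=.
  by move=> vr i _; exact: vr.
by move=> vr i; exact: vr (mem_index_enum i).
Qed.

Lemma lebesgue_compact_lty A : compact A -> (lebesgue_rV A < +oo)%E.
Proof.
move=> cA; have [M M0 AM] := compact_coord_bounded cA.
apply: le_lt_trans (ltry ((2 * M) ^+ n)); rewrite -(lebesgue_cube M0).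
apply: le_measure; rewrite ?inE//; [exact: compact_measurable_rV|exact: measurable_cube].
Qed.

Lemma lebesgue_compactE A : compact A -> lebesgue_rV A = (vol A)%:E.
Proof. by move=> cA; rewrite /vol fineK// ge0_fin_numE// lebesgue_compact_lty. Qed.

Lemma measurable_dot (a f : 'rV[R]_n) :
  measurable_fun setT (fun x : 'rV[R]_n => dot (x - a) f : measurableTypeR R).
Proof.
under eq_fun do rewrite dotE.
apply: measurable_sum => k; apply: measurable_funM => //.
under eq_fun do rewrite mxE.
by apply: measurable_funD => //; exact: measurable_coord_mx.
Qed.

Lemma integrable_coord A k : compact A ->
  (@lebesgue_rV R n).-integrable A (EFin \o (fun x => x 0 k)).
Proof.
move=> cA; apply: measurable_bounded_integrable.
- exact: compact_measurable_rV.
- exact: lebesgue_compact_lty.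
- by apply: measurable_funTS; exact: measurable_coord_mx.
- have [M M0 AM] := compact_coord_bounded cA.
  exists M; split; first exact: num_real.
  by move=> N MN x Ax; apply: le_trans (ltW MN); exact: AM.
Qed.

Lemma integrable_cst_compact A (r : R) : compact A ->
  (@lebesgue_rV R n).-integrable A (EFin \o (fun=> r)).
Proof.
move=> cA; apply: measurable_bounded_integrable.
- exact: compact_measurable_rV.
- exact: lebesgue_compact_lty.
- exact: measurable_cst.
- exists `|r|; split; first exact: num_real.
  by move=> N MN x Ax; exact: ltW MN.
Qed.

Lemma integrable_dot A a f : compact A ->
  (@lebesgue_rV R n).-integrable A (EFin \o (fun x => dot (x - a) f)).
Proof.
move=> cA; have [M M0 AM] := compact_coord_bounded cA.
apply: measurable_bounded_integrable.
- exact: compact_measurable_rV.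
- exact: lebesgue_compact_lty.
- by apply: measurable_funTS; exact: measurable_dot.
- exists (\sum_k (M + `|a 0 k|) * `|f 0 k|); split; first exact: num_real.
  move=> N MN x Ax; apply: le_trans (ltW MN); rewrite dotE.
  apply: (le_trans (ler_norm_sum _ _ _)); apply: ler_sum => k _.
  rewrite normrM ler_wpM2r// !mxE (le_trans (ler_normB _ _))// lerD2r.
  exact: AM.
Qed.

(** The vector on the right is the first moment of [A] about [a]; for positive volume it vanishes
    exactly when [a] is the barycenter. *)
Lemma Rintegral_dot A a f : compact A ->
  \int[@lebesgue_rV R n]_(x in A) dot (x - a) f =
  dot ((\row_k \int[@lebesgue_rV R n]_(x in A) x 0 k) - vol A *: a) f.
Proof.
move=> cA; have mA := compact_measurable_rV cA.
have ik k : (@lebesgue_rV R n).-integrable A (fun x => (x 0 k * f 0 k)%:E).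
  have := integrableZl mA (f 0 k) (integrable_coord k cA).
  by apply: eq_integrable => // x _; rewrite /= -EFinM mulrC.
rewrite (_ : \int[_]_(x in A) _ =
    \int[@lebesgue_rV R n]_(x in A) ((\sum_k x 0 k * f 0 k) - dot a f)); last first.
  by apply: eq_Rintegral => x _; rewrite dotDl dotNl dotE.
rewrite RintegralB//; last 2 first.
- have := @integrable_sum _ _ _ _ _ mA _ (index_enum 'I_n) xpredT _ (fun k _ => ik k).
  by apply: eq_integrable => // x _; rewrite /= sumEFin.
- exact: integrable_cst_compact.
rewrite Rintegral_cst// -/(vol A) dotDl dotNl dotZl [in RHS]mulrC; congr (_ - _).
rewrite dotE /Rintegral; under eq_integral do rewrite -sumEFin.
rewrite integral_sum// -sum_fine; last by move=> k _; exact: integrable_fin_num.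
apply: eq_bigr => k _; rewrite mxE.
exact: (RintegralZr (f 0 k) mA (integrable_coord k cA)).
Qed.

End compact_integrals.

Section barycenter.
Context {R : realType} {n : nat}.
Local Notation mu := (@lebesgue_rV R n).

Lemma barycenter_dot_le (K : set 'rV[R]_n) y : compact K -> 0 < vol K ->
  (forall a c, K a -> K c -> dot (a - c) y <= 1) ->
  forall x, K x -> dot (x - barycenter K) y <= 1.
Proof.
move=> cK v0 Ky x Kx; have mK := compact_measurable_rV cK.
have : - vol K <= \int[mu]_(z in K) dot (z - x) y.
  rewrite -mulN1r -(Rintegral_cst _ mK); apply: le_Rintegral => //.
  - exact: integrable_cst_compact.
  - exact: integrable_dot.
  - move=> z Kz; rewrite lerNl -dotNl opprB; exact: Ky.
rewrite Rintegral_dot// /barycenter; set J := \row_i _.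
rewrite !dotDl !dotNl !dotZl => h.
have vV : vol K * (vol K)^-1 = 1 by rewrite divff// gt_eqF.
rewrite -(ler_pM2l v0) mulr1 mulrBr mulrA vV mul1r; lra.
Qed.

(** Such an [s] pushes Lebesgue measure forward to itself; [g >= 0] allows the change of variables
    formula for nonnegative functions. *)
Lemma dilates1_integral (S : set 'rV[R]_n) (s : 'rV[R]_n -> 'rV[R]_n) (g : 'rV[R]_n -> R) :
  dilates 1 s -> measurable S -> s @^-1` S = S ->
  measurable_fun setT (g : _ -> measurableTypeR R) -> (forall x, S x -> 0 <= g x) ->
  \int[mu]_(x in S) g (s x) = \int[mu]_(x in S) g x.
Proof.
move=> [ms ds] mS sS mg g0; rewrite /Rintegral; congr fine.
rewrite -{1}sS -(ge0_integral_pushforward ms mu mS (f := EFin \o g)).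
- by apply: eq_measure_integral => A mA _; exact: etrans (ds A mA) (mul1e _).
- by apply/measurable_EFinP; exact: measurable_funTS.
- by move=> x /set_mem Sx; rewrite lee_fin g0.
Qed.

Variables (b : 'rV[R]_n) (F : 'M[R]_n).
Hypothesis uF : F \in unitmx.
Let uFT : F^T \in unitmx. Proof. by rewrite unitmx_tr. Qed.
Local Notation S := (dual_simplex b F).
Local Notation fn := (facet_normal F).

Lemma compact_dual_simplex : compact S.
Proof.
pose M := \sum_i \sum_k `|dual_vertex b F i 0 k|.
apply: (@bounded_closed_compact_mx _ _ _ _ M).
  rewrite dual_simplex_hull// => x; move=> /(_ [set x | forall i j, `|x i j| <= M]); apply.
  split.
    apply: segment_convex_set => u v t uM vM t0 t1 i j; rewrite !mxE.
    rewrite (le_trans (ler_normD _ _))// !normrM (ger0_norm t0).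
    have t1' : 0 <= 1 - t by rewrite subr_ge0.
    rewrite (ger0_norm t1').
    have := ler_wpM2l t0 (uM i j); have := ler_wpM2l t1' (vM i j); lra.
  move=> _ [i _ <-] j k; rewrite ord1 /M (bigD1 i)//= (bigD1 k)//= -addrA lerDl.
  by rewrite addr_ge0// sumr_ge0// => ? _; rewrite sumr_ge0.
rewrite (_ : S = \bigcap_(i in setT) (fun x => dot (x - b) (fn i)) @^-1` `]-oo, 1]).
  apply: closed_bigI => i _; apply: closed_preimage.
    by apply: continuous_dot; [apply: continuous_addmx|] => z;
      [exact: cvg_id|exact: cst_continuous|exact: cst_continuous].
  exact: lray_closed.
apply/seteqP; split => x Sx i; first by move=> _; rewrite /= in_itv/=; exact: Sx.
by have := Sx i Logic.I; rewrite /= in_itv.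
Qed.

(* The affine involution that exchanges the vertices opposite to the facets
   [ord0] and [lift ord0 j] preserves both the volume and the simplex. *)
Lemma dual_simplex_swap j : exists s : 'rV[R]_n -> 'rV[R]_n,
  [/\ dilates 1 s, s @^-1` S = S &
    forall x, dot (s x - b) (fn ord0) = dot (x - b) (fn (lift ord0 j))].
Proof.
(* [d] has product 1 with normal [lift ord0 j], -1 with normal [ord0] and 0 with the others, so
   adding [<x - b, e> d] exchanges two products and keeps the rest. *)
pose d := row j (invmx F^T); pose e := fn ord0 - fn (lift ord0 j).
have dS k : dot d (fn (lift ord0 k)) = (k == j)%:R.
  rewrite facet_normalS -mulmx_tr_coord /d -row_mul mulVmx// !mxE.
  by rewrite eq_sym.
have d0 : dot d (fn ord0) = -1.
  have := sum_dot_facet_normal F d; rewrite big_ord_recl (bigD1 j)//= dS eqxx.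
  rewrite big1 ?addr0; first by move/eqP; rewrite addr_eq0 => /eqP.
  by move=> k /negbTE kj; rewrite dS kj.
pose s x := x + dot (x - b) e *: d.
pose M := 1%:M + e^T *m d.
have sE x : s x = x *m M - dot b e *: d.
  rewrite /s /M mulmxDr mulmx1 mulmxA mulmx_tr_dot mul_scalar_mx dotDl dotNl.
  by rewrite scalerBl addrA.
have cs x i : dot (s x - b) (fn i) = dot (x - b) (fn i) + dot (x - b) e * dot d (fn i).
  by rewrite /s addrAC dotDl dotZl.
have s0 x : dot (s x - b) (fn ord0) = dot (x - b) (fn (lift ord0 j)).
  by rewrite cs d0 /e dotDr dotNr mulrN1 opprB addrC subrK.
have sj x : dot (s x - b) (fn (lift ord0 j)) = dot (x - b) (fn ord0).
  by rewrite cs dS eqxx /e dotDr dotNr mulr1 addrC subrK.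
have sk x k : k != j -> dot (s x - b) (fn (lift ord0 k)) = dot (x - b) (fn (lift ord0 k)).
  by move=> /negbTE kj; rewrite cs dS kj mulr0 addr0.
have sS x : S x -> S (s x).
  move=> Sx i; case: (unliftP ord0 i) => [k|] ->; last by rewrite s0.
  by have [->|kj] := eqVneq k j; [rewrite sj|rewrite sk].
have de : dot d e = - 2 by rewrite /e dotDr dotNr d0 dS eqxx /=; lra.
have ss x : s (s x) = x.
  rewrite {1}/s (_ : s x - b = x - b + dot (x - b) e *: d); last by rewrite /s addrAC.
  rewrite /s; set u := x - b; set t := dot u e.
  rewrite dotDl dotZl de -/t.
  apply/rowP => k; rewrite !mxE; ring.
(* Since [<d, e> = -2], [M] is an involution, whence [|det M| = 1]. *)
have MM : M *m M = 1%:M.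
  rewrite /M mulmxDr mulmx1 mulmxDl mul1mx mulmxA -(mulmxA e^T d) mulmx_tr_dot.
  by rewrite de mul_mx_scalar -scalemxAl; apply/matrixP => k l; rewrite !mxE; ring.
have uM : M \in unitmx by apply: (mulmx1_unit MM).1.
have detM : `|\det M| = 1.
  apply/eqP; rewrite -(@pexpr_eq1 _ _ 2)// expr2 -normrM -det_mulmx MM det1.
  by rewrite normr1.
exists s; split => //.
  apply: (eq_dilates (dilates_affine (- (dot b e *: d)) uM)) => [|x]; last by rewrite sE.
  by rewrite detM invr1.
apply/seteqP; split => x /=; last exact: sS.
by move=> /sS; rewrite ss.
Qed.

(** By the swaps, the first moment [J] about [b] has the same product with every normal. These
    products sum to zero, so all vanish, and [J = 0] because [F] is invertible. *)
Lemma barycenter_dual_simplex : barycenter S = b.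
Proof.
have cS := compact_dual_simplex; have mS := compact_measurable_rV cS.
have v0 : 0 < vol S.
  rewrite /vol lebesgue_dual_simplex//= !divr_gt0 ?exprn_gt0 ?ltr0n ?fact_gt0//.
  by rewrite normr_gt0 -unitfE -unitmxE.
pose J := (\row_k \int[mu]_(x in S) x 0 k) - vol S *: b.
have JE f : \int[mu]_(x in S) dot (x - b) f = dot J f by rewrite Rintegral_dot.
(* For a facet normal [f] this integrand is nonnegative on the simplex, as [dilates1_integral]
   demands. *)
have J1 f : \int[mu]_(x in S) (1 - dot (x - b) f) = vol S - dot J f.
  rewrite RintegralB// ?Rintegral_cst// ?mul1r ?JE//.
  - exact: integrable_cst_compact.
  - exact: integrable_dot.
have Jeq j : dot J (fn (lift ord0 j)) = dot J (fn ord0).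
  have [s [ds sS s0]] := dual_simplex_swap j.
  have := dilates1_integral ds mS sS (g := fun x => 1 - dot (x - b) (fn ord0)).
  move=> /(_ _ _)/wrap[||].
  - by apply: measurable_funB => //; exact: measurable_dot.
  - by move=> x Sx; rewrite subr_ge0; exact: Sx.
  under eq_Rintegral do rewrite s0.
  by rewrite !J1; lra.
have J0 : dot J (fn ord0) = 0.
  have := sum_dot_facet_normal F J; rewrite big_ord_recl; under eq_bigr do rewrite Jeq.
  rewrite sumr_const card_ord -[X in X + _]mulr1n -mulrnDr add1n => /eqP.
  by rewrite mulrn_eq0 => /eqP.
have : J *m F^T = 0.
  by apply/rowP => j; rewrite mulmx_tr_coord -facet_normalS Jeq J0 mxE.
move=> /(congr1 (fun z => z *m invmx F^T)); rewrite mulmxK// mul0mx => /eqP.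
rewrite subr_eq0 => /eqP JS; rewrite /barycenter JS scalerA mulVf ?scale1r//.
by rewrite gt_eqF.
Qed.

End barycenter.

(** * Convex bodies *)

Section convex_bodies.
Context {R : realType} {n : nat}.
Implicit Types K : set 'rV[R]_n.

Lemma convex_body_cube K : convex_body K -> exists (x0 : 'rV[R]_n) (rho : R),
  0 < rho /\ forall x : 'rV[R]_n, (forall i, `|(x - x0) 0 i| <= rho) -> K x.
Proof.
move=> [_ _ [x0 /nbhs_ballP[e /= e0 eK]]]; exists x0, (e / 2).
split=> [|x xe]; first by rewrite divr_gt0.
apply: eK; rewrite -ball_normE /= -normrN opprB.
by rewrite (le_lt_trans (@le_normrV _ _ _ (e / 2) _ xe))//; lra.
Qed.

Lemma convex_body_vol_gt0 K : convex_body K -> 0 < vol K.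
Proof.
move=> KB; have [cK _ _] := KB; have [x0 [rho [rho0 rhoK]]] := convex_body_cube KB.
have [mt dt] := dilates_translate (- x0).
rewrite -lte_fin -lebesgue_compactE//.
apply: (@lt_le_trans _ _ ((2 * rho) ^+ n)%:E).
  by rewrite lte_fin exprn_gt0// mulr_gt0.
rewrite -lebesgue_cube// -[leLHS]mul1e -dt; last exact: measurable_cube.
apply: le_measure; rewrite ?inE//.
- exact: measurable_preimageT mt (measurable_cube _).
- exact: compact_measurable_rV.
Qed.

Definition difference_body K := [set x | exists a c, [/\ K a, K c & x = a - c]].

Definition difference_polar K := [set y | forall a c, K a -> K c -> dot (a - c) y <= 1].

Lemma compact_difference_body K : compact K -> compact (difference_body K).
Proof.
move=> cK; rewrite (_ : difference_body K =
    (fun p : 'rV[R]_n * 'rV[R]_n => p.1 + p.2 *m (-1)%:M) @` (K `*` K)).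
  apply: continuous_compact; last exact: compact_setX.
  apply: continuous_subspaceT; apply: continuous_addmx; first by move=> ?; exact: cvg_fst.
  by apply: continuous_mulmx => ?; [exact: cvg_snd|exact: cst_continuous].
apply/seteqP; split => x.
  move=> [a [c [Ka Kc ->]]]; exists (a, c) => //=.
  by rewrite mul_mx_scalar scaleN1r.
by move=> [[a c] [/= Ka Kc] <-]; exists a, c; split=> //; rewrite mul_mx_scalar scaleN1r.
Qed.

Lemma convex_difference_body K : convex_set K -> convex_set (difference_body K).
Proof.
move=> cK; apply: segment_convex_set => _ _ t [a [c [Ka Kc ->]]] [a' [c' [Ka' Kc' ->]]] t0 t1.
exists (t *: a + (1 - t) *: a'), (t *: c + (1 - t) *: c'); split.
- exact: convex_set_segment.
- exact: convex_set_segment.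
- by rewrite !scalerBr opprD addrACA.
Qed.

(** If [|v| <= 1], then [<v T^T, y> = <v, yT> <= 1] on the polar, so [v T^T] is in [K - K] by
    [bipolar]. The unit ball is replaced by its inscribed cube of half-side [1 / sqrt n], whose
    volume is explicit. *)
Lemma ellipsoid_volume K (T : 'M[R]_n) : (0 < n)%N -> convex_body K -> 0 < \det T ->
  (forall y, difference_polar K y -> dot (y *m T) (y *m T) <= 1) ->
  \det T * (2 * (Num.sqrt n%:R)^-1) ^+ n <= 4 ^+ n * vol K.
Proof.
move=> n0 KB detT polT; have [cK cvK [x0 Kx0]] := KB.
have vK := convex_body_vol_gt0 KB; have mK := compact_measurable_rV cK.
have n0' : 0 < n%:R :> R by rewrite ltr0n.
have s0 : 0 < (Num.sqrt n%:R)^-1 :> R by rewrite invr_gt0 sqrtr_gt0.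
have uT : T^T \in unitmx by rewrite unitmx_tr unitmxE unitfE gt_eqF.
have [mi di] := dilates_mulmx (n := n) (M := invmx T^T) (ltac:(by rewrite unitmx_inv)).
pose C := [set v : 'rV[R]_n | forall i, `|v 0 i| <= (Num.sqrt n%:R)^-1].
have mC : measurable C by exact: measurable_cube.
have -> : \det T * (2 * (Num.sqrt n%:R)^-1) ^+ n =
    fine (lebesgue_rV ((fun x => x *m invmx T^T) @^-1` C)).
  by rewrite di// lebesgue_cube//= det_inv det_tr normfV invrK gtr0_norm.
have {}Kx0 : K x0 by exact: interior_subset Kx0.
rewrite -lee_fin EFinM -(lebesgue_compactE cK) fineK; last by rewrite di// lebesgue_cube.
apply: difference_body_volume => //.
- exact: measurable_preimageT mi mC.
- by rewrite lebesgue_compactE// lte_fin.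
- exact: lebesgue_compact_lty.
- move=> x Cx; apply: bipolar (compact_difference_body cK) (convex_difference_body cvK) _ _.
    by exists x0, x0; rewrite subrr.
  move=> y Ly; rewrite -(mulmxKV uT x) dot_mulmx trmxK.
  have Py : difference_polar K y by move=> a c Ka Kc; apply: Ly; exists a, c.
  apply: (dot_le1 ler01 ler01 _ (polT _ Py)); last by rewrite mulr1.
  rewrite dotE (le_trans (_ : _ <= \sum_(i < n) n%:R^-1))//; last first.
    by rewrite sumr_const card_ord -[_ *+ n]mulr_natl divff// gt_eqF.
  apply: ler_sum => i _; rewrite -expr2 -real_normK ?num_real//.
  have -> : n%:R^-1 = (Num.sqrt n%:R)^-1 ^+ 2 :> R.
    by rewrite exprVn sqr_sqrtr// ltW.
  by apply: lerXn2r; [rewrite nnegrE|rewrite nnegrE ltW|exact: Cx i].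
Qed.

End convex_bodies.

(** * Construction of the facet normals *)

Section facets.
Context {R : realType}.

(** Two block triangular factorisations of the same matrix are compared. *)
Lemma det_sub_outer n (u : 'cV[R]_n) (v : 'rV[R]_n) :
  \det (1%:M - u *m v) = 1 - (v *m u) 0 0.
Proof.
pose B : 'M[R]_(1 + n) := block_mx 1%:M v u 1%:M.
have E1 : B = block_mx 1%:M 0 u 1%:M *m block_mx 1%:M v 0 (1%:M - u *m v).
  by rewrite mulmx_block !mulmx1 !mul1mx !mul0mx !addr0 addrC subrK.
have E2 : B = block_mx (1%:M - v *m u) v 0 1%:M *m block_mx 1%:M 0 u 1%:M.
  by rewrite mulmx_block !mulmx1 !mul1mx !mulmx0 !add0r subrK.
have : \det B = \det (1%:M - u *m v) by rewrite E1 det_mulmx det_lblock det_ublock !det1 !mul1r.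
rewrite E2 det_mulmx det_lblock det_ublock !det1 !mulr1 => <-.
by rewrite [X in \det X]mx11_scalar det_scalar1 !mxE.
Qed.

(** Induction, with [(1 + 1/n)^n <= e] as the step. *)
Lemma exprn_le_fact n : n%:R ^+ n <= expR 1 ^+ n * n`!%:R :> R.
Proof.
elim: n => [|n IH]; first by rewrite !expr0 mul1r.
have [->|n0] := eqVneq n 0%N.
  by rewrite !expr1 mulr1 (le_trans _ (expR_ge1Dx 1))//; lra.
have n0' : 0 < n%:R :> R by rewrite ltr0n lt0n.
have step : n.+1%:R ^+ n <= expR 1 * n%:R ^+ n :> R.
  have -> : n.+1%:R = (1 + n%:R^-1) * n%:R :> R.
    by rewrite -natr1; field; rewrite gt_eqF.
  rewrite exprMn ler_wpM2r ?exprn_ge0//.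
  rewrite (_ : expR 1 = expR n%:R^-1 ^+ n); last first.
    by rewrite -expRM_natr mulVf// gt_eqF.
  apply: lerXn2r; [|by rewrite nnegrE expR_ge0|exact: expR_ge1Dx].
  by rewrite nnegrE addr_ge0// invr_ge0.
rewrite exprS factS natrM exprS.
rewrite [leRHS](_ : _ = n.+1%:R * (expR 1 * (expR 1 ^+ n * n`!%:R))); last by ring.
by rewrite ler_wpM2l// (le_trans step)// ler_wpM2l ?expR_ge0.
Qed.

(** The rows of [F] are the vectors [(w_i - g) / 2] carried back by [T^-1]; with the divisor [n + 1]
    in [g], minus their sum is [- g / 2] carried back. The last clause is the Dvoretzky-Rogers bound
    on [det W], whose Gram product is [n! / (2n)^n]. *)
Lemma convex_body_facets n (K : set 'rV[R]_n) : (0 < n)%N -> convex_body K ->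
  exists T F : 'M[R]_n, [/\ 0 < \det T,
    forall y, difference_polar K y -> dot (y *m T) (y *m T) <= 1,
    forall i, difference_polar K (facet_normal F i) &
    n`!%:R / (2 * n%:R) ^+ n <= (2 ^+ n * n.+1%:R * (\det T * \det F)) ^+ 2].
Proof.
move=> n0 KB; have [cK _ _] := KB.
have [x0 [rho [rho0 rhoK]]] := convex_body_cube KB.
have [M M0 KM] := compact_coord_bounded cK.
have n0' : 0 < n%:R :> R by rewrite ltr0n.
pose Y := difference_polar K.
have YN y : Y y -> Y (- y).
  by move=> Yy a c Ka Kc; rewrite dotNr -dotNl opprB; exact: Yy.
have Kx0 : K x0 by apply: rhoK => i; rewrite subrr mxE normr0 ltW.
(* The cube of half-side [rho] inside [K] bounds each coordinate on [Y] by [1 / rho]. *)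
have Yr y : Y y -> dot y y <= n%:R * rho ^- 2.
  move=> Yy; have yi z i : Y z -> z 0 i <= rho^-1.
    move=> Yz; have := Yz (x0 + rho *: delta_mx 0 i) x0.
    rewrite addrAC subrr add0r dotZl dotC dot_delta => /(_ _ Kx0)/wrap[].
      apply: rhoK => k; rewrite addrAC subrr add0r !mxE eqxx/= normrM normr_nat gtr0_norm//.
      by case: (k == i); rewrite ?mulr1 ?mulr0// ltW.
    by rewrite -ler_pdivlMl// mulr1.
  rewrite dotE (le_trans (_ : _ <= \sum_(i < n) rho ^- 2))//; last first.
    by rewrite sumr_const card_ord mulr_natl.
  apply: ler_sum => i _; rewrite -expr2 -exprVn -real_normK ?num_real//.
  apply: lerXn2r; [by rewrite nnegrE|by rewrite nnegrE invr_ge0 ltW|].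
  rewrite ler_norml yi// andbT lerNl.
  by have := yi _ i (YN _ Yy); rewrite mxE.
have Ye i : Y ((2 * M)^-1 *: delta_mx 0 i).
  move=> a c Ka Kc; rewrite dotZr dot_delta !mxE ler_pdivrMl ?mulr_gt0// mulr1.
  have := KM a Ka i; have := KM c Kc i; rewrite !ler_norml => /andP[? ?] /andP[? ?].
  lra.
have [T [detT YT trT]] := loewner_position
  (r := n%:R * rho ^- 2) (rho := (2 * M)^-1) ltac:(by rewrite mulr_gt0// invr_gt0 exprn_gt0)
  ltac:(by rewrite invr_gt0 mulr_gt0) Yr Ye.
have uT : T \in unitmx by rewrite unitmxE unitfE gt_eqF.
have [W [YW detW sumW]] := @dvoretzky_rogers R n [set w | exists2 y, Y y & w = y *m T]
  ltac:(by move=> _ [y Yy ->]; exists (- y); [exact: YN|rewrite mulNmx])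
  ltac:(by move=> _ [y Yy ->]; exact: YT)
  ltac:(by move=> A s As; apply: trT => y Yy; apply: As; exists y)
  n (leqnn n).
pose g := n.+1%:R^-1 *: \sum_i row i W.
have n10 : n.+1%:R != 0 :> R by rewrite pnatr_eq0.
pose z (x : 'rV[R]_n) := x *m (invmx T)^T.
have zE x w : dot x (w *m invmx T) = dot (z x) w.
  by rewrite dotC dot_mulmx dotC.
have zT x y : dot (z x) (y *m T) = dot x y by rewrite -zE mulmxK.
(* The trace inequality for the rank-one matrix [w^T w] with [s = 1]:
   [<w, yT>^2 = <a - c, y>^2 <= 1] on [Y]. *)
have z_le a c : K a -> K c -> dot (z (a - c)) (z (a - c)) <= n%:R.
  move=> Ka Kc; set w := z _; rewrite -[leRHS]mul1r.
  have <- : \tr (w^T *m w) = dot w w by rewrite mxtrace_mulC mulmx_tr_dot mxtrace_scalar.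
  apply: trT => y Yy; rewrite mulmxA mulmx_tr_dot mul_scalar_mx dotZl (dotC _ w) zT.
  have := Yy a c Ka Kc; have := Yy c a Kc Ka.
  rewrite -(opprB a c) dotNl; nra.
(* Cauchy-Schwarz with [|z|^2 <= n] and [|g|^2 <= n / (n + 1)^2]. *)
have zg_le a c : K a -> K c -> dot (z (a - c)) g <= 1.
  move=> Ka Kc; apply: (dot_le1 (b := n%:R / n.+1%:R ^+ 2) _ _ (z_le _ _ Ka Kc)) => //.
  - by rewrite /g dotZl dotZr mulrA -expr2 exprVn mulrC ler_wpM2r// invr_ge0 exprn_ge0.
  - rewrite mulrA ler_pdivrMr ?exprn_gt0// mul1r -expr2.
    by apply: lerXn2r; rewrite ?nnegrE// ler_nat.
have zg_ge a c : K a -> K c -> - dot (z (a - c)) g <= 1.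
  by move=> Ka Kc; rewrite -dotNl /z -mulNmx opprB; exact: zg_le.
pose u : 'cV[R]_n := const_mx 1.
pose F := 2^-1 *: ((W - u *m g) *m invmx T).
have dotF x j : dot x (row j F) = 2^-1 * (dot (z x) (row j W) - dot (z x) g).
  rewrite /F linearZ/= dotZr row_mul zE linearB/= dotDr dotNr row_mul.
  by rewrite (_ : row j u = 1%:M) ?mul1mx//; apply/matrixP => k l; rewrite !mxE !ord1.
exists T, F; split => //.
- move=> i a c Ka Kc; case: (unliftP ord0 i) => [j|] ->.
    rewrite facet_normalS dotF; have [y Yy ->] := YW j; rewrite zT.
    have := Yy a c Ka Kc; have := zg_ge a c Ka Kc; lra.
  rewrite facet_normal0 dotNr dotC dot_suml.
  under eq_bigr do rewrite dotC dotF.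
  rewrite -mulr_sumr sumrB sumr_const card_ord.
  have -> : \sum_(i < n) dot (z (a - c)) (row i W) = n.+1%:R * dot (z (a - c)) g.
    by rewrite -dotZr /g scalerA divff// scale1r dotC dot_suml; under eq_bigr do rewrite dotC.
  have := zg_ge a c Ka Kc; rewrite -[dot _ _ *+ n]mulr_natl -(natr1 n).
  by rewrite mulrDl mul1r [_ * _ + _]addrC addrK; lra.
(* Subtracting [g] from every row multiplies [W] by a rank-one perturbation of the identity, of
   determinant [1 - n / (n + 1) = 1 / (n + 1)]. *)
- have -> : 2 ^+ n * n.+1%:R * (\det T * \det F) = \det W.
    have gE : g = (n.+1%:R^-1 *: const_mx 1) *m W.
      rewrite /g -scalemxAl; congr (_ *: _); apply/rowP => k.
      by rewrite summxE mxE; apply: eq_bigr => j _; rewrite !mxE mul1r.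
    have -> : F = 2^-1 *: ((1%:M - u *m (n.+1%:R^-1 *: const_mx 1)) *m W *m invmx T).
      by rewrite /F gE; congr (_ *: (_ *m _)); rewrite mulmxBl mul1mx mulmxA.
    rewrite detZ !det_mulmx det_sub_outer det_inv -scalemxAl mxE.
    have -> : ((const_mx 1 : 'rV[R]_n) *m u) 0 0 = n%:R.
      rewrite mxE (eq_bigr (fun=> 1)) ?sumr_const ?card_ord// => j _.
      by rewrite !mxE mul1r.
    rewrite -natr1 exprVn; field.
    by rewrite nat1r n10 gt_eqF//= expf_neq0.
  have := detW; rewrite det_mulmx det_tr -expr2; apply: le_trans.
  rewrite prodf_div prodr_const card_ord -natr_prod -ffact_prod ffactnn.
  by [].
Qed.

End facets.

(** * The numerical estimate and the conclusion *)

(** Here [t], [f], [v] stand for [det T], [det F], [vol K]. The constant collects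
    [(n+1)^n <= (2e)^n n!], [1 <= (2e)^n |X|], [n + 1 <= 2^n], the factor [2^n] in [X], and
    [t <= (2 sqrt n)^n v]. *)
Lemma dual_simplex_ratio_le (R : realType) n (t f v : R) : (0 < n)%N -> 0 < t -> 0 < v ->
  n`!%:R / (2 * n%:R) ^+ n <= (2 ^+ n * n.+1%:R * (t * f)) ^+ 2 ->
  t * (2 * (Num.sqrt n%:R)^-1) ^+ n <= 4 ^+ n * v ->
  n.+1%:R ^+ n / n`!%:R / `|f| / v <= (32 * expR 1 ^+ 2 * Num.sqrt n%:R) ^+ n.
Proof.
move=> n0 t0 v0 hf ht.
set e := expR 1 : R; set q := Num.sqrt n%:R : R; set X := 2 ^+ n * n.+1%:R * (t * f) in hf.
have n0' : 0 < n%:R :> R by rewrite ltr0n.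
have q0 : 0 < q by rewrite sqrtr_gt0.
have e1 : 1 <= e by rewrite (le_trans _ (expR_ge1Dx 1))//; lra.
have e0 : 0 < e by rewrite (lt_le_trans _ e1).
have fact0' : 0 < n`!%:R :> R by rewrite ltr0n fact_gt0.
have hfact : n%:R ^+ n <= e ^+ n * n`!%:R by exact: exprn_le_fact.
(* Squaring reduces this to [(2e)^n X^2 >= 1] times [(2e)^n >= 1]; the loss of [(2e)^(n/2)] only
   affects the constant. *)
have hX : 1 <= (2 * e) ^+ n * `|X|.
  have e2 : 1 <= (2 * e) ^+ n by rewrite exprn_ege1//; lra.
  have hX2 : ((2 * e) ^+ n)^-1 <= X ^+ 2.
    apply: le_trans hf; rewrite ler_pdivlMr ?exprn_gt0 ?mulr_gt0//.
    rewrite ler_pdivrMl ?exprn_gt0 ?mulr_gt0// !exprMn -mulrA.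
    by rewrite ler_wpM2l// exprn_ge0.
  rewrite -(@expr_ge1 _ 2)//; last by rewrite mulr_ge0// exprn_ge0// mulr_ge0// ltW.
  rewrite exprMn -normrX (ger0_norm (sqr_ge0 X)) expr2 -mulrA.
  apply: mulr_ege1 => //.
  by rewrite -ler_pdivrMl ?(lt_le_trans _ e2)// mulr1.
have f0 : 0 < `|f|.
  rewrite normr_gt0; move: hX; rewrite /X; apply: contraTneq => ->.
  by rewrite !mulr0 normr0 mulr0 -ltNge.
have tv : t <= (2 * q) ^+ n * v.
  have : t * (2 * q^-1) ^+ n * (q / 2) ^+ n <= 4 ^+ n * v * (q / 2) ^+ n.
    by rewrite ler_wpM2r// exprn_ge0// divr_ge0// ltW.
  rewrite -mulrA -exprMn (_ : 2 * q^-1 * (q / 2) = 1); last by field; rewrite gt_eqF.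
  rewrite expr1n mulr1 mulrAC -exprMn (_ : 4 * (q / 2) = 2 * q)//; lra.
have absX : `|X| = 2 ^+ n * n.+1%:R * (t * `|f|).
  by rewrite /X !normrM normrX !normr_nat (gtr0_norm t0).
have n2 : n.+1%:R <= 2 * n%:R :> R by rewrite -natr1 mulr_natl mulr2n lerD2l ler1n.
have n2n : n.+1%:R <= 2 ^+ n :> R by rewrite -natrX ler_nat ltn_expl.
rewrite ler_pdivrMr// ler_pdivrMr// ler_pdivrMr//.
have -> : (32 * e ^+ 2 * q) ^+ n * v * `|f| * n`!%:R =
    2 ^+ n * (e ^+ n * n`!%:R) * ((2 * e) ^+ n * (2 ^+ n * 2 ^+ n * ((2 * q) ^+ n * v * `|f|))).
  rewrite (_ : 32 * e ^+ 2 * q = 2 * e * (2 * e) * 2 * 2 * (2 * q)); last by ring.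
  by rewrite !exprMn; move: (2 ^+ n) (e ^+ n) (q ^+ n) => a b c; ring.
rewrite -[leLHS]mulr1; apply: ler_pM => //.
- apply: (@le_trans _ _ ((2 * n%:R) ^+ n)).
    by apply: lerXn2r; rewrite ?nnegrE ?mulr_ge0.
  by rewrite exprMn ler_wpM2l// exprn_ge0.
- apply: (le_trans hX); rewrite absX ler_wpM2l ?exprn_ge0 ?mulr_ge0 ?(ltW e0)//.
  apply: ler_pM => //.
  + by rewrite mulr_ge0// ltW.
  + by rewrite ler_wpM2l// exprn_ge0.
  + by rewrite ler_wpM2r// ltW.
Qed.

Theorem theorem1p3 (R : realType) :
  exists2 d : R, 0 < d &
    forall (n : nat) (K : set 'rV[R]_n), (1 <= n)%N -> convex_body K ->
      exists S : set 'rV[R]_n,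
        [/\ simplex S,
            K `<=` S,
            barycenter S = barycenter K &
            (vol S / vol K) `^ n%:R^-1 <= d * Num.sqrt n%:R].
Proof.
exists (32 * expR 1 ^+ 2); first by rewrite mulr_gt0// exprn_gt0// expR_gt0.
move=> n K n0 KB; have [cK _ _] := KB; have vK := convex_body_vol_gt0 KB.
have [T [F [detT polT Fpol hF]]] := convex_body_facets n0 KB.
have ratio := dual_simplex_ratio_le n0 detT vK hF (ellipsoid_volume n0 KB detT polT).
(* A zero determinant would make the right side of [hF] vanish, while its left side is positive. *)
have uF : F \in unitmx.
  rewrite unitmxE unitfE; apply: contraTneq hF => ->.
  rewrite !mulr0 expr0n/= -ltNge divr_gt0 ?ltr0n ?fact_gt0//.
  by rewrite exprn_gt0// mulr_gt0// ltr0n.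
exists (dual_simplex (barycenter K) F); split.
- exact: simplex_dual_simplex.
- by move=> x Kx i; apply: barycenter_dot_le => //; exact: Fpol.
- exact: barycenter_dual_simplex.
- have d0 : 0 <= 32 * expR 1 ^+ 2 * Num.sqrt n%:R :> R.
    by rewrite mulr_ge0 ?sqrtr_ge0// mulr_ge0// exprn_ge0// expR_ge0.
  rewrite [vol (dual_simplex _ _)]/vol lebesgue_dual_simplex// [fine _]/=.
  apply: (@le_trans _ _ (((32 * expR 1 ^+ 2 * Num.sqrt n%:R) ^+ n) `^ n%:R^-1)).
    rewrite ge0_ler_powR ?nnegrE ?exprn_ge0//.
    by rewrite !divr_ge0 ?exprn_ge0// ltW.
  by rewrite -powR_mulrn// -powRrM divff ?powRr1// pnatr_eq0 -lt0n.
Qed.
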